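(* Let $\mathcal A$ be a Banach operator ideal and let $E$ and $F$ be Banach spaces, with $E$ separable. If $F$ is a dual space, or $E'$ has the approximation property, or $\mathcal A^{\min}$ is regular, then $$(\mathrm{Lip}_0\circ\mathcal A^{\min}\circ\mathrm{Lip}_0)(E,F)\cap\mathcal L(E,F)=\mathcal A^{\min}(E,F)\quad\text{isometrically.}$$
   Context: Banach spaces are real; $\mathcal L(E,F)$ is the space of bounded linear operators, $\overline{\mathcal F}(E,F)$ the operator-norm closure of the finite-rank operators (approximable operators), $J_F\colon F\to F''$ the canonical inclusion. A Banach operator ideal $\mathcal A$ is a Banach ideal of bounded linear operators in the sense of Pietsch, with norm $\|\cdot\|_{\mathcal A}$. Its minimal kernel is $\mathcal A^{\min}=\overline{\mathcal F}\circ\mathcal A\circ\overline{\mathcal F}$, i.e. operators $T=R\circ S\circ U$ with $U,R$ approximable and $S\in\mathcal A$, with norm $\inf\|R\|\|S\|_{\mathcal A}\|U\|$. The regular hull $\mathcal B^{\mathrm{reg}}$ of a Banach operator ideal $\mathcal B$ consists of all $T\colon E\to F$ with $J_F\circ T\in\mathcal B(E,F'')$, with norm $\|J_F\circ T\|_{\mathcal B}$; $\mathcal B$ is regular if it coincides with $\mathcal B^{\mathrm{reg}}$ (with equal norms). $\mathrm{Lip}_0(X,Y)$ is the set of Lipschitz maps $X\to Y$ between pointed metric spaces preserving the base point $0$ (the origin for Banach spaces), and $\mathrm{Lip}(f)$ is the least Lipschitz constant. For a Banach operator ideal $\mathcal B$, $\mathrm{Lip}_0\circ\mathcal B\circ\mathrm{Lip}_0(E,F)$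 is the set of $f=g_2\circ T\circ g_1$ with $G_1,G_2$ Banach spaces, $g_1\in\mathrm{Lip}_0(E,G_1)$, $T\in\mathcal B(G_1,G_2)$, $g_2\in\mathrm{Lip}_0(G_2,F)$, with norm $\inf\mathrm{Lip}(g_1)\|T\|_{\mathcal B}\mathrm{Lip}(g_2)$ over such factorizations. ''Isometrically'' means the norm of $\mathrm{Lip}_0\circ\mathcal A^{\min}\circ\mathrm{Lip}_0$ restricted to linear operators equals $\|\cdot\|_{\mathcal A^{\min}}$. *)

(* Defs.v *)
From HB Require Import structures.
From mathcomp Require Import all_boot all_order all_algebra.
From mathcomp Require Import all_classical all_reals all_analysis.

Set Implicit Arguments.
Unset Strict Implicit.
Unset Printing Implicit Defensive.

Import Order.TTheory GRing.Theory Num.Theory.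
Import numFieldNormedType.Exports.

Local Open Scope classical_set_scope.
Local Open Scope ring_scope.

Reserved Notation "''L' ( E , F )" (at level 0, format "''L' ( E ,  F )").

Section BoundedOperators.
Context {R : realType}.
Implicit Types E F G : normedModType R.

Definition bounded_linear E F (f : E -> F) : Prop :=
  linear f /\ exists M : R, forall x, `|f x| <= M * `|x|.

Definition bounded_linear_pred E F : {pred E -> F} :=
  fun f => `[< bounded_linear f >].

Record blop E F := Blop {
  blop_fun :> E -> F;
  blop_subproof : blop_fun \in @bounded_linear_pred E F }.

End BoundedOperators.

Notation "''L' ( E , F )" := (blop E F) : type_scope.

Section BlopLmodule.
Context {R : realType} (E F : normedModType R).

HB.instance Definition _ := [isSub for @blop_fun R E F].
HB.instance Definition _ := [Choice of 'L(E, F) by <:].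

Lemma bounded_linear_submod_closed : submod_closed (@bounded_linear_pred R E F).
Proof.
split=> [|a f g /asboolP[fl [M fM]] /asboolP[gl [N gN]]]; apply/asboolP.
  split=> [b u v|]; first by change (0 = b *: 0 + 0 :> F); rewrite scaler0 addr0.
  by exists 0 => x; change (`|0 : F| <= 0 * `|x|); rewrite normr0 mul0r.
split=> [b u v|].
  change (a *: f (b *: u + v) + g (b *: u + v) =
    b *: (a *: f u + g u) + (a *: f v + g v)).
  by rewrite fl gl !scalerDr !scalerA (mulrC a b) addrACA.
exists (`|a| * M + N) => x; rewrite (le_trans (ler_normD _ _))// mulrDl.
by rewrite lerD// normrZ -mulrA ler_wpM2l.
Qed.

HB.instance Definition _ := GRing.isSubmodClosed.Build R (E -> F)
  (@bounded_linear_pred R E F) bounded_linear_submod_closed.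
HB.instance Definition _ := [SubChoice_isSubLmodule of 'L(E, F) by <:].

Lemma blopP (T : 'L(E, F)) : bounded_linear T.
Proof. exact/asboolP/blop_subproof. Qed.

HB.instance Definition _ (T : 'L(E, F)) :=
  GRing.isLinear.Build R E F *:%R T (blopP T).1.

Lemma blop_eqP (S T : 'L(E, F)) : S =1 T -> S = T.
Proof. by move=> ST; apply/val_inj/funext. Qed.

Lemma blopD (S T : 'L(E, F)) x : (S + T) x = S x + T x.
Proof. by []. Qed.

Lemma blopN (T : 'L(E, F)) x : (- T) x = - T x.
Proof. by []. Qed.

Lemma blopZ a (T : 'L(E, F)) x : (a *: T) x = a *: T x.
Proof. by []. Qed.

Lemma blop0 x : (0 : 'L(E, F)) x = 0.
Proof. by []. Qed.

Definition mkblop (f : E -> F) (fP : bounded_linear f) : 'L(E, F) :=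
  Blop (asboolT fP).

End BlopLmodule.

Section OperatorNorm.
Context {R : realType} (E F : normedModType R).

Definition op_bounds (f : E -> F) : set R :=
  [set M | 0 <= M /\ forall x, `|f x| <= M * `|x|].

Definition opnorm (T : 'L(E, F)) : R := inf (op_bounds T).

Lemma op_bounds_neq0 (T : 'L(E, F)) : op_bounds T !=set0.
Proof.
have [_ [M TM]] := blopP T; exists `|M|; split=> // x.
by rewrite (le_trans (TM x))// ler_wpM2r// ler_norm.
Qed.

Lemma op_bounds_lb (T : 'L(E, F)) : lbound (op_bounds T) 0.
Proof. by move=> M []. Qed.

Lemma opnorm_le (T : 'L(E, F)) M : 0 <= M -> (forall x, `|T x| <= M * `|x|) ->
  opnorm T <= M.
Proof.
by move=> M0 TM; apply: ge_inf; [exists 0; exact: op_bounds_lb|split].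
Qed.

Lemma opnorm_ge0 (T : 'L(E, F)) : 0 <= opnorm T.
Proof. by apply: lb_le_inf; [exact: op_bounds_neq0|exact: op_bounds_lb]. Qed.

Lemma opnormP (T : 'L(E, F)) x : `|T x| <= opnorm T * `|x|.
Proof.
have [->|x0] := eqVneq x 0; first by rewrite linear0 !normr0 mulr0.
rewrite -ler_pdivrMr ?normr_gt0//; apply: lb_le_inf.
  exact: op_bounds_neq0.
by move=> M [_ TM]; rewrite ler_pdivrMr ?normr_gt0.
Qed.

Lemma opnormD (S T : 'L(E, F)) : opnorm (S + T) <= opnorm S + opnorm T.
Proof.
apply: opnorm_le => [|x]; first by rewrite addr_ge0 ?opnorm_ge0.
by rewrite blopD mulrDl (le_trans (ler_normD _ _))// lerD ?opnormP.
Qed.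

Let opnormZ_le a (T : 'L(E, F)) : opnorm (a *: T) <= `|a| * opnorm T.
Proof.
apply: opnorm_le => [|x]; first by rewrite mulr_ge0 ?opnorm_ge0.
by rewrite blopZ normrZ -mulrA ler_wpM2l ?opnormP.
Qed.

Lemma opnormZ a (T : 'L(E, F)) : opnorm (a *: T) = `|a| * opnorm T.
Proof.
apply/eqP; rewrite eq_le opnormZ_le/=.
have [->|a0] := eqVneq a 0; first by rewrite normr0 mul0r opnorm_ge0.
have := opnormZ_le a^-1 (a *: T).
rewrite scalerA mulVf// scale1r normfV mulrC ler_pdivlMr ?normr_gt0//.
by rewrite mulrC.
Qed.

Lemma opnorm0_eq0 (T : 'L(E, F)) : opnorm T = 0 -> T = 0.
Proof.
move=> T0; apply: blop_eqP => x; apply/eqP; rewrite -normr_le0.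
by have := opnormP T x; rewrite T0 mul0r.
Qed.

HB.instance Definition _ :=
  Lmodule_isNormed.Build R 'L(E, F) opnormD opnormZ opnorm0_eq0.

Lemma blop_normE (T : 'L(E, F)) : `|T| = inf (op_bounds T).
Proof. by []. Qed.

Lemma ler_blop (T : 'L(E, F)) x : `|T x| <= `|T| * `|x|.
Proof. exact: opnormP. Qed.

End OperatorNorm.

Section Completeness.
Context {R : realType} (E : normedModType R) (F : completeNormedModType R).

Lemma blop_complete (U : set_system 'L(E, F)) :
  ProperFilter U -> cauchy U -> cvg U.
Proof.
move=> UF /cauchy_ballP Uc.
have Unear (e : R) : 0 < e ->
    exists2 B, U B & forall S T, B S -> B T -> `|S - T| < e.
  move=> e0; have [[B C] /= [UB UC] BC] := Uc _ e0.
  exists (B `&` C) => [|S T [BS _] [_ CT]]; first exact: filterI.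
  by have := BC (S, T) (conj BS CT); rewrite -ball_normE.
have ev_le (S T : 'L(E, F)) x : `|S x - T x| <= `|S - T| * `|x|.
  exact: (opnormP (S - T) x).
pose f x := lim ((fun T : 'L(E, F) => T x) @ U).
have ev_cvg x : (fun T : 'L(E, F) => T x) @ U --> f x.
  apply: cauchy_cvg; apply/cauchy_ballP => e e0.
  have d0 : 0 < e / (`|x| + 1) by rewrite divr_gt0// ltr_wpDl.
  have [B UB Bd] := Unear _ d0.
  have UBx : U [set T | ((fun S : 'L(E, F) => S x) @` B) (T x)].
    by apply: filterS UB => T BT; exists T.
  exists ((fun T : 'L(E, F) => T x) @` B, (fun T : 'L(E, F) => T x) @` B) => //.
  move=> [_ _] /= [[S BS <-] [T BT <-]]; rewrite -ball_normE/=.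
  rewrite (le_lt_trans (ev_le S T x))//.
  rewrite (@le_lt_trans _ _ (e / (`|x| + 1) * `|x|))//.
    by rewrite ler_wpM2r// ltW// Bd.
  by rewrite mulrAC ltr_pdivrMr ?ltr_wpDl// ltr_pM2l// ltrDl.
have flin : linear f.
  move=> a u v; apply: (@cvg_unique _ (@norm_hausdorff _ F) _ _ _ _ (ev_cvg _)).
  have -> : (fun T : 'L(E, F) => T (a *: u + v)) =
            (fun T : 'L(E, F) => a *: T u + T v).
    by apply/funext => T; rewrite linearP.
  by apply: cvgD => //; apply: cvgZl_tmp.
have f_dist (e : R) : 0 < e ->
    U [set T : 'L(E, F) | forall x, `|f x - T x| <= e * `|x|].
  move=> /Unear[B UB Be]; apply: (filterS _ UB) => T BT x.
  have fT : (fun S : 'L(E, F) => `|S x - T x|) @ U --> `|f x - T x|.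
    by apply: cvg_norm; apply: cvgB => //; exact: cvg_cst.
  apply: (cvgr_to_le fT); apply: (filterS _ UB) => S BS /=.
  by rewrite (le_trans (ev_le S T x))// ler_wpM2r// ltW// Be.
have fbnd : exists M : R, forall x, `|f x| <= M * `|x|.
  have [T fT] := filter_ex (f_dist 1 ltr01).
  exists (1 + `|T|) => x; rewrite -(subrK (T x) (f x)) mulrDl.
  by rewrite (le_trans (ler_normD _ _))// lerD//; exact: opnormP.
pose L : 'L(E, F) := mkblop (conj flin fbnd).
apply/cvg_ex; exists L; apply/cvgrPdist_le => e e0.
apply: (filterS _ (f_dist e e0)) => T fT.
by apply: opnorm_le; [exact: ltW|exact: fT].
Qed.

HB.instance Definition _ := Uniform_isComplete.Build 'L(E, F) blop_complete.

End Completeness.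

Section Composition.
Context {R : realType}.
Implicit Types E F G : normedModType R.

Lemma bounded_linear_comp E F G (S : 'L(F, G)) (T : 'L(E, F)) :
  bounded_linear (S \o T).
Proof.
split=> [a u v|]; first by rewrite /= !linearP.
exists (`|S| * `|T|) => x; rewrite /= (le_trans (ler_blop S _))//.
by rewrite -mulrA ler_wpM2l//; exact: ler_blop.
Qed.

Definition blop_comp E F G (S : 'L(F, G)) (T : 'L(E, F)) : 'L(E, G) :=
  mkblop (bounded_linear_comp S T).

Lemma bounded_linear_id E : bounded_linear (@idfun E).
Proof. by split=> //; exists 1 => x; rewrite mul1r. Qed.

Definition blop_id E : 'L(E, E) := mkblop (@bounded_linear_id E).

End Composition.

Notation "S \oL T" := (blop_comp S T) (at level 50, left associativity).

Definition dual {R : realType} (E : normedModType R) : completeNormedModType R :=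
  'L(E, R^o).

Section CanonicalInclusion.
Context {R : realType} (E : normedModType R).

Lemma bounded_linear_eval (x : E) :
  bounded_linear (fun phi : dual E => (phi : 'L(E, R^o)) x : R^o).
Proof.
split=> //; exists `|x| => phi.
by rewrite mulrC; exact: (ler_blop (phi : 'L(E, R^o)) x).
Qed.

Definition bidual_eval (x : E) : dual (dual E) :=
  mkblop (bounded_linear_eval x).

Lemma bounded_linear_bidual_eval : bounded_linear bidual_eval.
Proof.
split=> [a x y|]; first by apply: blop_eqP => phi; exact: linearP.
exists 1 => x; rewrite mul1r; apply: opnorm_le => // phi.
by rewrite mulrC; exact: (ler_blop (phi : 'L(E, R^o)) x).
Qed.

Definition bidual_inclusion : 'L(E, dual (dual E)) :=
  mkblop bounded_linear_bidual_eval.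

End CanonicalInclusion.

Section BanachSpaceProperties.
Context {R : realType}.

Definition finite_rank (E F : normedModType R) : set 'L(E, F) :=
  [set T | exists (n : nat) (v : 'I_n -> F),
    forall x, exists c : 'I_n -> R, T x = \sum_(i < n) c i *: v i].

Definition approximable (E F : normedModType R) : set 'L(E, F) :=
  closure (@finite_rank E F).

Definition approximation_property (E : completeNormedModType R) : Prop :=
  forall (K : set E) (e : R), compact K -> 0 < e ->
    exists2 T : 'L(E, E), finite_rank T & forall x, K x -> `|T x - x| <= e.

Definition separable (E : completeNormedModType R) : Prop :=
  exists2 D : set E, countable D & dense D.

(* "Being a dual space" is understood isometrically. *)
Definition is_dual_space (F : completeNormedModType R) : Prop :=
  exists (G : completeNormedModType R) (J : 'L(F, dual G)),
    bijective J /\ forall y, `|J y| = `|y|.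

End BanachSpaceProperties.

(* A class of operators between Banach spaces with a real number attached to
   each operator; `op_norm` is only meaningful on members of the class. *)
Record op_class (R : realType) := OpClass {
  op_mem :> forall E F : completeNormedModType R, set 'L(E, F);
  op_norm : forall E F : completeNormedModType R, 'L(E, F) -> R }.

Arguments op_mem {R} o E F.
Arguments op_norm {R} o {E F}.

Section OperatorIdeals.
Context {R : realType}.
Implicit Types (A B : op_class R) (E F G H : completeNormedModType R).

(* The axioms of Pietsch.  Some of them are redundant: they also say explicitly
   that each component is a linear space, normed by `op_norm A`. *)
Record banach_operator_ideal A : Prop := BanachOperatorIdeal {
  ideal_id : A R^o R^o (blop_id R^o);
  ideal_id_norm : op_norm A (blop_id R^o) = 1;
  ideal0 : forall E F, A E F 0;
  idealD : forall E F (S T : 'L(E, F)), A E F S -> A E F T -> A E F (S + T);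
  idealZ : forall E F (a : R) (T : 'L(E, F)), A E F T -> A E F (a *: T);
  ideal_norm_ge0 : forall E F (T : 'L(E, F)), A E F T -> 0 <= op_norm A T;
  ideal_normD : forall E F (S T : 'L(E, F)), A E F S -> A E F T ->
    op_norm A (S + T) <= op_norm A S + op_norm A T;
  ideal_normZ : forall E F (a : R) (T : 'L(E, F)), A E F T ->
    op_norm A (a *: T) = `|a| * op_norm A T;
  ideal_norm0_eq0 : forall E F (T : 'L(E, F)), A E F T ->
    op_norm A T = 0 -> T = 0;
  ideal_comp : forall E F G H (U : 'L(E, F)) (S : 'L(F, G)) (V : 'L(G, H)),
    A F G S -> A E H (V \oL S \oL U);
  ideal_norm_comp :
    forall E F G H (U : 'L(E, F)) (S : 'L(F, G)) (V : 'L(G, H)),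
    A F G S -> op_norm A (V \oL S \oL U) <= `|V| * op_norm A S * `|U|;
  ideal_complete : forall E F (u : nat -> 'L(E, F)), (forall n, A E F (u n)) ->
    (forall e : R, 0 < e -> exists N : nat, forall m n : nat,
      (N <= m)%N -> (N <= n)%N -> op_norm A (u m - u n) < e) ->
    exists2 T : 'L(E, F), A E F T &
      forall e : R, 0 < e -> exists N : nat, forall n : nat,
        (N <= n)%N -> op_norm A (u n - T) < e }.

Definition minimal_kernel A : op_class R := OpClass
  (fun E F => [set T | exists G H (U : 'L(E, G)) (S : 'L(G, H)) (V : 'L(H, F)),
    [/\ approximable U, A G H S, approximable V & T = V \oL S \oL U]])
  (fun E F T => inf [set r : R |
    exists G H (U : 'L(E, G)) (S : 'L(G, H)) (V : 'L(H, F)),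
    [/\ approximable U, A G H S, approximable V, T = V \oL S \oL U &
        r = `|V| * op_norm A S * `|U|]]).

Definition regular_hull B : op_class R := OpClass
  (fun E F => [set T | B E (dual (dual F)) (bidual_inclusion F \oL T)])
  (fun E F T => op_norm B (bidual_inclusion F \oL T)).

Definition regular_ideal B : Prop :=
  (forall E F, B E F = regular_hull B E F) /\
  (forall E F (T : 'L(E, F)), B E F T ->
    op_norm B T = op_norm (regular_hull B) T).

End OperatorIdeals.

Section LipschitzFactorization.
Context {R : realType}.
Implicit Types (B : op_class R) (E F G : completeNormedModType R).

Definition Lip0 E F : set (E -> F) := [set f | lipschitz f /\ f 0 = 0].

Definition Lip E F (f : E -> F) : R :=
  inf [set k : R | 0 <= k /\ k.-lipschitz f].

Definition lip_comp B E F : set (E -> F) :=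
  [set f | exists G1 G2 (g1 : E -> G1) (T : 'L(G1, G2)) (g2 : G2 -> F),
    [/\ Lip0 g1, B G1 G2 T, Lip0 g2 & f = g2 \o T \o g1]].

Definition lip_comp_norm B E F (f : E -> F) : R :=
  inf [set r : R |
    exists G1 G2 (g1 : E -> G1) (T : 'L(G1, G2)) (g2 : G2 -> F),
    [/\ Lip0 g1, B G1 G2 T, Lip0 g2, f = g2 \o T \o g1 &
        r = Lip g1 * op_norm B T * Lip g2]].

End LipschitzFactorization.

Arguments lip_comp {R} B E F _.

(* Main.v *)
(* Let f = g2 o V o S o U o g1 be linear, with U, V approximable and S in A.
   An energy argument over dyadic scales, with an invariant mean on E in place of
   Lebesgue measure, shows that finitely many Lipschitz functions on E are always
   simultaneously almost affine around some point, at some scale.  Hence the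
   difference quotients of U o g1 converge, along an ultrafilter of points and
   scales, to a linear operator D; the convergence is in norm and D is
   approximable because U is, and |D| <= |U| Lip(g1).  Rescaling g2 at the same
   points and scales gives Lip(g2)-Lipschitz maps h with h(V S D x) -> f x.
   Averaging them over almost invariant boxes, as Lindenstrauss does with an
   invariant mean, gives asymptotically linear Lip(g2)-Lipschitz maps that still
   tend to f on the range of V S D.
   If F is a dual space, their weak-star limit L is linear, |L| <= Lip(g2) and
   f = (L V) S D.  The same holds for J f in the bidual of F, which settles the
   regular case.  If E' has the approximation property, D is the limit of
   operators D P with P of finite rank, and f P = V' S D P for some finite rank V'
   of norm at most Lip(g2) |V| + e, because only a finite dimensional part of the
   asymptotically linear maps matters; f is then the sum of a fast convergent
   telescoping series of such products, which belongs to the minimal kernel. *)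

From HB Require Import structures.
Require Import Defs.
From mathcomp Require Import all_boot all_order all_algebra.
From mathcomp Require Import all_classical all_reals all_analysis.
From mathcomp Require Import ring lra.

Set Implicit Arguments.
Unset Strict Implicit.
Unset Printing Implicit Defensive.

Import Order.TTheory GRing.Theory Num.Theory.
Import numFieldNormedType.Exports.
Local Open Scope classical_set_scope.
Local Open Scope ring_scope.

(** A Lipschitz map into a Banach space need not be differentiable anywhere, and [g1] and [g2]
    cannot be treated alike. Averaging [g1] would not commute with the nonlinear [g2], so [g1] is
    linearized by localization: at one point and one scale the difference quotients of [g1] and [g2]
    still compose to [f], because a linear map is its own difference quotient. Once the inner factor
    is linear, averaging the outer one respects the equation. The second obstacle is that limits of
    the averaged maps exist only weak-star. A predual or the bidual can hold such a limit; [F]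
    itself can only be reached with finite dimensional data, which is why the approximation property
    leads to a series instead of one factorization. Its terms have different outer factors but share
    [S], so a single member of the ideal has to be assembled from countably many weighted copies of
    [S]. None of the limits increases a norm beyond an arbitrarily small error, hence the equality
    of norms. *)

Section HahnBanach.
Context {R : realType} {V : lmodType R}.
Implicit Types (p q : V -> R) (x y : V).

Definition sublinear p : Prop :=
  (forall x y, p (x + y) <= p x + p y) /\
  (forall (t : R) x, 0 <= t -> p (t *: x) = t * p x).

Lemma sublinear_of_le p : (forall x y, p (x + y) <= p x + p y) -> p 0 = 0 ->
  (forall (t : R) x, 0 < t -> p (t *: x) <= t * p x) -> sublinear p.
Proof.
move=> pD p0 pZ; split=> // t x; rewrite le_eqVlt => /predU1P[<-|t0].
  by rewrite scale0r mul0r.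
apply/eqP; rewrite eq_le pZ//=.
have := pZ t^-1 (t *: x); rewrite invr_gt0 scalerA mulVf ?gt_eqF// scale1r.
by move=> /(_ t0); rewrite mulrC ler_pdivlMr// mulrC.
Qed.

Lemma sublinear0 p : sublinear p -> p 0 = 0.
Proof. by move=> [_ pZ]; rewrite -(scale0r 0) pZ// mul0r. Qed.

Lemma sublinear_lb p x : sublinear p -> - p (- x) <= p x.
Proof.
by move=> sp; have := sp.1 x (- x); rewrite subrr (sublinear0 sp); lra.
Qed.

(* Passing to the tangent in the direction [y] makes [p] linear along [y]. *)
Definition tangent p y x : R := inf [set p (x + t *: y) - t * p y | t in [set t : R | 0 <= t]].

Lemma tangent_lb p y x (t : R) : sublinear p -> 0 <= t ->
  - p (- x) <= p (x + t *: y) - t * p y.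
Proof.
move=> sp t0; rewrite -(sp.2 t)//.
have := sp.1 (x + t *: y) (- x); rewrite addrAC subrr add0r; lra.
Qed.

Lemma tangent_le p y x (t : R) : sublinear p -> 0 <= t ->
  tangent p y x <= p (x + t *: y) - t * p y.
Proof.
move=> sp t0; apply: ge_inf; last by exists t.
by exists (- p (- x)) => _ [s s0 <-]; exact: tangent_lb.
Qed.

Lemma tangent_ge p y x (c : R) : (forall t : R, 0 <= t -> c <= p (x + t *: y) - t * p y) ->
  c <= tangent p y x.
Proof.
move=> h; apply: lb_le_inf; last by move=> _ [t t0 <-]; exact: h.
by exists (p (x + 0 *: y) - 0 * p y); exists 0 => /=.
Qed.

Lemma sublinear_tangent p y : sublinear p -> sublinear (tangent p y).
Proof.
move=> sp; apply: sublinear_of_le.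
- move=> x z; rewrite -lerBlDr; apply: tangent_ge => s s0.
  rewrite lerBlDr -lerBlDl; apply: tangent_ge => t t0.
  have := tangent_le y (x + z) sp (addr_ge0 s0 t0).
  have := sp.1 (x + s *: y) (z + t *: y).
  rewrite addrACA -scalerDl; lra.
- apply/eqP; rewrite eq_le; apply/andP; split.
    have := tangent_le y 0 sp (lexx 0).
    by rewrite scale0r mul0r addr0 subr0 (sublinear0 sp).
  apply: tangent_ge => t t0; have := tangent_lb y 0 sp t0.
  by rewrite !oppr0 (sublinear0 sp) oppr0.
- move=> t x t0; rewrite mulrC -ler_pdivrMr//; apply: tangent_ge => s s0.
  rewrite ler_pdivrMr//.
  have := tangent_le y (t *: x) sp (mulr_ge0 (ltW t0) s0).
  by rewrite -scalerA -scalerDr sp.2 ?(ltW t0)//; lra.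
Qed.

Lemma sublinear_minimal p : sublinear p -> exists q,
  [/\ sublinear q, forall x, q x <= p x &
    forall r, sublinear r -> (forall x, r x <= q x) -> r = q].
Proof.
move=> sp; pose T := {q | sublinear q /\ forall x, q x <= p x}.
have pT : sublinear p /\ forall x, p x <= p x by [].
pose below (q r : T) := `[< forall x, sval r x <= sval q x >].
have [|||[q [sq qp]] qmin] := @ZL_preorder T (exist _ p pT) below.
- by move=> q; apply/asboolP.
- move=> r q s /asboolP qr /asboolP rs; apply/asboolP => x.
  exact: le_trans (rs x) (qr x).
- move=> C totC; have [[q0 Cq0]|C0] := pselect (C !=set0); last first.
    exists (exist _ p pT) => q Cq; exfalso; apply: C0; by exists q.
  pose m x := inf [set sval q x | q in C].
  have lbm x : has_lbound [set sval q x | q in C].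
    exists (- p (- x)) => _ [[q [sq qp]] Cq <-] /=.
    by rewrite (le_trans _ (sublinear_lb x sq))// lerN2.
  have m_le (q : T) x : C q -> m x <= sval q x.
    by move=> Cq; apply: ge_inf => //; exists q.
  have m_ge x c : (forall q : T, C q -> c <= sval q x) -> c <= m x.
    move=> h; apply: lb_le_inf; last by move=> _ [q Cq <-]; exact: h.
    by exists (sval q0 x); exists q0.
  have sm : sublinear m.
    apply: sublinear_of_le.
    + move=> x y; rewrite -lerBlDr; apply: (@m_ge) => q Cq.
      rewrite lerBlDr -lerBlDl; apply: (@m_ge) => r Cr.
      rewrite lerBlDl.
      have [/asboolP qr|/asboolP rq] := totC _ _ Cq Cr.
        rewrite (le_trans (m_le _ _ Cr))// (le_trans ((svalP r).1.1 x y))//.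
        by rewrite lerD2r.
      rewrite (le_trans (m_le _ _ Cq))// (le_trans ((svalP q).1.1 x y))//.
      by rewrite lerD2l.
    + apply/eqP; rewrite eq_le (le_trans (m_le _ _ Cq0)) ?(sublinear0 (svalP q0).1)//=.
      by apply: (@m_ge) => q _; rewrite (sublinear0 (svalP q).1).
    + move=> t x t0; rewrite mulrC -ler_pdivrMr//; apply: (@m_ge) => q Cq.
      by rewrite ler_pdivrMr// mulrC -(svalP q).1.2 ?(ltW t0)// m_le.
  have mp x : m x <= p x by rewrite (le_trans (m_le _ _ Cq0))// (svalP q0).2.
  by exists (exist _ m (conj sm mp)) => q Cq; apply/asboolP => x; exact: m_le.
exists q; split=> // r sr rq.
have rp x : r x <= p x by exact: le_trans (rq x) (qp x).
have /asboolP/= qr := qmin (exist _ r (conj sr rp)) (asboolT rq).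
by apply/funext => x; apply/eqP; rewrite eq_le rq qr.
Qed.

(* A minimal sublinear functional equals its tangents, hence is linear. *)
Lemma hahn_banach p x0 : sublinear p -> exists phi : V -> R^o,
  [/\ linear phi, forall x, phi x <= p x & phi x0 = p x0].
Proof.
(* Minimality is sought below the tangent at [x0], because [tangent p x0 (- x0) <= - p x0]; this is
   what forces [q x0 = p x0]. *)
move=> sp; have [q [sq qp qmin]] := sublinear_minimal (sublinear_tangent x0 sp).
have tp x : tangent p x0 x <= p x.
  by have := tangent_le x0 x sp (lexx 0); rewrite scale0r mul0r addr0 subr0.
have qD x y : q (x + y) = q x + q y.
  apply/eqP; rewrite eq_le sq.1/=.
  have tq z : tangent q y z <= q z.
    by have := tangent_le y z sq (lexx 0); rewrite scale0r mul0r addr0 subr0.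
  rewrite -{1}(qmin _ (sublinear_tangent y sq) tq) -lerBrDr.
  by have := tangent_le y x sq ler01; rewrite scale1r mul1r.
have qN x : q (- x) = - q x.
  by apply/eqP; rewrite -addr_eq0 addrC -qD subrr sublinear0.
have qZ t x : q (t *: x) = t * q x.
  have [t0|/ltW t0] := leP 0 t; first exact: sq.2.
  by rewrite -{1}(opprK t) scaleNr qN sq.2 ?oppr_ge0// mulNr opprK.
exists q; split=> [t x y|x|].
- by rewrite qD qZ.
- by rewrite (le_trans (qp x)).
- apply/eqP; rewrite eq_le (le_trans (qp x0))//= -lerN2 -qN (le_trans (qp _))//.
  have := tangent_le x0 (- x0) sp ler01.
  by rewrite scale1r addNr (sublinear0 sp) mul1r sub0r.
Qed.

End HahnBanach.

(** * Norming functionals *)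

Section NormedHahnBanach.
Context {R : realType} {E : normedModType R}.

Lemma hahn_banach_normed (p : E -> R) K x0 : sublinear p -> 0 <= K ->
    (forall x, p x <= K * `|x|) ->
  exists phi : dual E,
    [/\ `|phi| <= K, forall x, (phi : 'L(_, _)) x <= p x & (phi : 'L(_, _)) x0 = p x0].
Proof.
move=> sp K0 pK; have [phi [phil phip phix0]] := hahn_banach x0 sp.
have phiK x : `|phi x| <= K * `|x|.
  rewrite ler_norml (le_trans (phip x))// andbT.
  have -> : phi x = - phi (- x).
    by rewrite -[in RHS]scaleN1r -[- _ *: _]addr0 phil scaleN1r opprD opprK;
       have := phil (-1) 0 0; rewrite scaler0 addr0 scaleN1r addNr => ->; rewrite oppr0 addr0.
  by rewrite lerN2 (le_trans (phip _))// (le_trans (pK _))// normrN.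
exists (mkblop (conj phil (ex_intro _ K phiK))); split=> //.
exact: opnorm_le.
Qed.

Lemma norming_functional (x : E) :
  exists2 phi : dual E, `|phi| <= 1 & (phi : 'L(_, _)) x = `|x|.
Proof.
have sn : sublinear (fun y : E => `|y|).
  by split=> [y z|t y t0]; rewrite ?ler_normD// normrZ ger0_norm.
have [|phi [phi1 _ phix]] := hahn_banach_normed x sn ler01.
  by move=> y; rewrite mul1r.
by exists phi.
Qed.

Lemma normed_le_dual (x : E) c :
  (forall phi : dual E, `|phi| <= 1 -> (phi : 'L(_, _)) x <= c) -> `|x| <= c.
Proof. by move=> h; have [phi phi1 <-] := norming_functional x; exact: h. Qed.

Lemma eq0_dual (x : E) : (forall phi : dual E, (phi : 'L(_, _)) x = 0) -> x = 0.
Proof.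
move=> h; apply/eqP; rewrite -normr_le0; apply: normed_le_dual => phi _.
by rewrite h.
Qed.

End NormedHahnBanach.

Notation "<[ phi , x ]>" := ((phi : blop _ _) x) (at level 0, format "<[ phi ,  x ]>").

(** * Operator norms, pairings and rank one operators *)

Section OperatorBounds.
Context {R : realType}.
Implicit Types E F G : normedModType R.

Lemma blop_norm_le E F (T : 'L(E, F)) (M : R) : 0 <= M ->
  (forall x, `|T x| <= M * `|x|) -> `|T| <= M.
Proof. exact: opnorm_le. Qed.

Lemma blop_comp_norm E F G (S : 'L(F, G)) (T : 'L(E, F)) :
  `|S \oL T| <= `|S| * `|T|.
Proof.
apply: blop_norm_le; first exact: mulr_ge0.
move=> x; rewrite -mulrA (le_trans (ler_blop S _))//.
by rewrite ler_wpM2l// ler_blop.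
Qed.

Lemma blop_norm_le_dual E F (T : 'L(E, F)) (M : R) : 0 <= M ->
  (forall x (phi : dual F), `|phi| <= 1 -> <[phi, T x]> <= M * `|x|) -> `|T| <= M.
Proof.
move=> M0 h; apply: blop_norm_le => // x; apply: normed_le_dual => phi phi1.
exact: h.
Qed.

Lemma ler_pairing E (phi : dual E) x : `|<[phi, x]>| <= `|phi| * `|x|.
Proof. exact: (ler_blop (phi : 'L(E, R^o)) x). Qed.

Lemma pairingZ E (phi : dual E) (a : R) x :
  <[phi, a *: x]> = a * <[phi, x]> :> R.
Proof. exact: linearZ. Qed.

Lemma pairingD E (phi : dual E) x y :
  <[phi, x + y]> = <[phi, x]> + <[phi, y]> :> R.
Proof. exact: linearD. Qed.

Lemma pairingB E (phi : dual E) x y :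
  <[phi, x - y]> = <[phi, x]> - <[phi, y]> :> R.
Proof. exact: linearB. Qed.

Lemma pairingP E (phi : dual E) (a : R) x y :
  <[phi, a *: x + y]> = a * <[phi, x]> + <[phi, y]> :> R.
Proof. exact: linearP. Qed.

Lemma pairingBl E (phi psi : dual E) x :
  <[phi - psi, x]> = <[phi, x]> - <[psi, x]> :> R.
Proof. by []. Qed.

Lemma pairingZl E (phi : dual E) (a : R) x : <[a *: phi, x]> = a * <[phi, x]> :> R.
Proof. by []. Qed.

Lemma bounded_linear_rank1 E F (phi : dual E) (v : F) :
  bounded_linear (fun x => (<[phi, x]> : R) *: v).
Proof.
split=> [a x y|]; first by rewrite pairingP scalerDl scalerA.
exists (`|phi| * `|v|) => x; rewrite normrZ mulrAC ler_wpM2r//.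
exact: ler_pairing.
Qed.

Definition rank1 E F (phi : dual E) (v : F) : 'L(E, F) :=
  mkblop (bounded_linear_rank1 phi v).

Lemma rank1_norm E F (phi : dual E) (v : F) : `|rank1 phi v| <= `|phi| * `|v|.
Proof.
apply: blop_norm_le => [|x]; first exact: mulr_ge0.
by rewrite [`|rank1 _ _ _|]normrZ mulrAC ler_wpM2r// ler_pairing.
Qed.

Lemma blop_sumE E F (I : Type) (s : seq I) (T : I -> 'L(E, F)) x :
  (\sum_(i <- s) T i) x = \sum_(i <- s) T i x.
Proof. by elim/big_rec2: _ => // i y S _ <-. Qed.

Lemma blop_compBl E F G (S1 S2 : 'L(F, G)) (T : 'L(E, F)) :
  (S1 - S2) \oL T = (S1 \oL T) - (S2 \oL T).
Proof. exact: blop_eqP. Qed.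

Lemma blop_compBr E F G (S : 'L(F, G)) (T1 T2 : 'L(E, F)) :
  S \oL (T1 - T2) = (S \oL T1) - (S \oL T2).
Proof. by apply: blop_eqP => x; rewrite /= raddfB. Qed.

Lemma blop_compA E F G (H : normedModType R) (S : 'L(G, H)) (T : 'L(F, G))
  (U : 'L(E, F)) : S \oL (T \oL U) = S \oL T \oL U.
Proof. exact: blop_eqP. Qed.

End OperatorBounds.

(** * Finite rank operators *)

Section FiniteRank.
Context {R : realType}.
Implicit Types E F G : normedModType R.

Lemma finite_rank_sum E F (T : 'L(E, F)) (I : Type) (s : seq I)
    (c : E -> I -> R) (v : I -> F) :
  (forall z, T z = \sum_(i <- s) c z i *: v i) -> finite_rank T.
Proof.
move=> Ts; exists (size s), (v \o tnth (in_tuple s)) => z.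
by exists (c z \o tnth (in_tuple s)); rewrite Ts big_tnth.
Qed.

(* Peeling off one dimension of the range at a time, each time by a functional
   provided by Hahn-Banach, represents [T] by finitely many of its own values. *)
Lemma finite_rank_repr E F (T : 'L(E, F)) : finite_rank T ->
  exists s : seq (E * dual F),
    forall z, T z = \sum_(i <- s) (<[i.2, T z]> : R) *: T i.1.
Proof.
move=> [n [v Tv]]; elim: n v T Tv => [|n IH] v T Tv.
  by exists [::] => z; have [c ->] := Tv z; rewrite big_ord0 big_nil.
have [T0|/existsNP[x /eqP Tx0]] := pselect (forall x, T x = 0).
  by exists [::] => z; rewrite big_nil T0.
have [phi0 _ phi0x] := norming_functional (T x).
pose phi : dual F := `|T x|^-1 *: phi0.
have phix : <[phi, T x]> = 1 :> R.
  by rewrite /phi/= [LHS]blopZ phi0x [_ *: _]mulVf// normr_eq0.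
pose P (w : F) := w - (<[phi, w]> : R) *: T x.
have PD a u w : P (a *: u + w) = a *: P u + P w.
  by rewrite /P pairingP scalerDl -scalerA scalerBr addrACA opprD.
have PZ a u : P (a *: u) = a *: P u.
  by rewrite /P pairingZ -scalerA scalerBr.
have Psum (I : Type) (s : seq I) (c : I -> R) (u : I -> F) :
    P (\sum_(i <- s) c i *: u i) = \sum_(i <- s) c i *: P (u i).
  elim: s => [|i s IHs]; first by rewrite !big_nil /P linear0 scale0r subr0.
  by rewrite !big_cons PD IHs.
have Px : P (T x) = 0 by rewrite /P phix scale1r subrr.
pose T1 : 'L(E, F) := T - rank1 ((phi : 'L(F, R^o)) \oL T : dual E) (T x).
have T1E z : T1 z = P (T z) by [].
have [c cx] := Tv x.
have [j cj] : exists j, c j != 0.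
  apply/existsP; apply: contraNT Tx0 => /existsPn c0; rewrite cx big1// => i _.
  by have := c0 i; rewrite negbK => /eqP ->; rewrite scale0r.
(* [P] kills [T x] and [c j] is nonzero, so [P (v j)] is a combination of the other [P (v i)]: the
   range of [T1] needs one spanning vector fewer. *)
have Pvj : P (v j) = \sum_(i < n) (- (c (lift j i) / c j)) *: P (v (lift j i)).
  have : \sum_(i < n.+1) c i *: P (v i) = 0 by rewrite -Psum -cx Px.
  rewrite (bigD1_ord j)//= => /eqP; rewrite addr_eq0 => /eqP cPv.
  rewrite -[LHS]scale1r -(mulVf cj) -scalerA cPv scalerN scaler_sumr -sumrN.
  by apply: eq_bigr => i _; rewrite scalerA scaleNr mulrC.
have [|s1 s1E] := IH (fun i => P (v (lift j i))) T1.
  move=> z; have [d dz] := Tv z.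
  exists (fun i => d (lift j i) - d j * (c (lift j i) / c j)).
  rewrite T1E dz Psum (bigD1_ord j)//= Pvj scaler_sumr -big_split/=.
  by apply: eq_bigr => i _; rewrite scalerA -scalerDl mulrN addrC.
(* The projection is absorbed on both sides: [P (T u)] is [T] at [u] minus a multiple of [x], and
   [i.2] composed with [P] is [i.2] minus a multiple of [phi]. *)
exists ((x, phi) :: [seq (i.1 - (<[phi, T i.1]> : R) *: x,
  i.2 - (<[i.2, T x]> : R) *: phi) | i <- s1]) => z.
rewrite big_cons big_map/=.
transitivity ((<[phi, T z]> : R) *: T x + T1 z); first by rewrite T1E /P addrC subrK.
congr (_ + _); rewrite s1E; apply: eq_bigr => i _; congr (_ *: _).
  by rewrite T1E /P pairingB pairingZ mulrC.
by rewrite linearB linearZ.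
Qed.

Lemma finite_rank_compl E F G (S : 'L(F, G)) (T : 'L(E, F)) :
  finite_rank S -> finite_rank (S \oL T).
Proof. by move=> [n [v Sv]]; exists n, v => x; exact: Sv. Qed.

Lemma finite_rank_compr E F G (S : 'L(F, G)) (T : 'L(E, F)) :
  finite_rank T -> finite_rank (S \oL T).
Proof.
move=> [n [v Tv]]; exists n, (S \o v) => x; have [c cx] := Tv x; exists c.
by rewrite /= cx linear_sum; apply: eq_bigr => i _; rewrite linearZ.
Qed.

Lemma finite_rankD E F (S T : 'L(E, F)) :
  finite_rank S -> finite_rank T -> finite_rank (S + T).
Proof.
move=> /finite_rank_repr[s sS] /finite_rank_repr[t tT].
pose c (z : E) (i : bool * (E * dual F)) : R :=
  if i.1 then <[i.2.2, S z]> else <[i.2.2, T z]>.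
apply: (@finite_rank_sum _ _ _ _
  ([seq (true, i) | i <- s] ++ [seq (false, i) | i <- t]) c
  (fun i => if i.1 then S i.2.1 else T i.2.1)) => z.
by rewrite big_cat/= !big_map/= -sS -tT.
Qed.

Lemma finite_rank0 E F : finite_rank (0 : 'L(E, F)).
Proof.
by exists 0%N, (fun _ => 0) => x; exists (fun _ => 0); rewrite big_ord0.
Qed.

Lemma finite_rankZ E F (a : R) (T : 'L(E, F)) :
  finite_rank T -> finite_rank (a *: T).
Proof.
move=> [n [v Tv]]; exists n, v => x; have [c cx] := Tv x.
exists (fun i => a * c i); rewrite blopZ cx scaler_sumr.
by apply: eq_bigr => i _; rewrite scalerA.
Qed.

Lemma finite_rank_rank1 E F (phi : dual E) (v : F) : finite_rank (rank1 phi v).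
Proof.
exists 1%N, (fun _ => v) => x; exists (fun _ => <[phi, x]>).
by rewrite big_ord1.
Qed.

Lemma finite_rank_bigsum E F (I : Type) (s : seq I) (T : I -> 'L(E, F)) :
  (forall i, finite_rank (T i)) -> finite_rank (\sum_(i <- s) T i).
Proof.
move=> Tf; elim/big_ind: _ => //; first exact: finite_rank0.
by move=> S U; exact: finite_rankD.
Qed.

End FiniteRank.

(** * Approximable operators *)

Section Approximable.
Context {R : realType}.
Implicit Types E F G : normedModType R.

Lemma approximableP E F (T : 'L(E, F)) : approximable T <->
  forall e : R, 0 < e -> exists2 S : 'L(E, F), finite_rank S & `|T - S| <= e.
Proof.
split=> [cT e e0|h B /nbhs_ballP[e/= e0 eB]].
  have [S [Sf]] := cT _ (nbhsx_ballx T e e0).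
  by rewrite -ball_normE/= => /ltW TS; exists S.
have [S Sf TS] := h (e / 2) (divr_gt0 e0 (ltr0Sn R 1)).
exists S; split=> //; apply: eB; rewrite -ball_normE/=.
by rewrite (le_lt_trans TS)// ltr_pdivrMr// ltr_pMr// ltr1n.
Qed.

Lemma approximable_finite_rank E F (T : 'L(E, F)) : finite_rank T -> approximable T.
Proof.
by move=> Tf; apply/approximableP => e /ltW e0; exists T => //; rewrite subrr normr0.
Qed.

Lemma approximable_limit E F (T : 'L(E, F)) :
  (forall e : R, 0 < e -> exists2 S : 'L(E, F), approximable S & `|T - S| <= e) ->
  approximable T.
Proof.
move=> h; apply/approximableP => e e0.
have e20 : 0 < e / 2 by rewrite divr_gt0.
have [S /approximableP/(_ _ e20)[S' S'f SS'] TS] := h _ e20.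
exists S' => //; rewrite -(subrK S T) -addrA (le_trans (ler_normD _ _))//.
by rewrite (splitr e) lerD.
Qed.

Lemma approximable_compl E F G (S : 'L(F, G)) (T : 'L(E, F)) :
  approximable S -> approximable (S \oL T).
Proof.
move=> /approximableP Sa; apply/approximableP => e e0.
have T10 : 0 < `|T| + 1 by rewrite ltr_wpDl.
have [S' S'f SS'] := Sa _ (divr_gt0 e0 T10).
exists (S' \oL T); first exact: finite_rank_compl.
rewrite -blop_compBl (le_trans (blop_comp_norm _ _))//.
rewrite (le_trans (ler_wpM2r _ SS'))// mulrAC ler_pdivrMr// ler_wpM2l ?(ltW e0)//.
by rewrite lerDl.
Qed.

Lemma approximable_compr E F G (S : 'L(F, G)) (T : 'L(E, F)) :
  approximable T -> approximable (S \oL T).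
Proof.
move=> /approximableP Ta; apply/approximableP => e e0.
have S10 : 0 < `|S| + 1 by rewrite ltr_wpDl.
have [T' T'f TT'] := Ta _ (divr_gt0 e0 S10).
exists (S \oL T'); first exact: finite_rank_compr.
rewrite -blop_compBr (le_trans (blop_comp_norm _ _))//.
rewrite (le_trans (ler_wpM2l _ TT'))// mulrCA ger_pMr// ler_pdivrMr// mul1r.
by rewrite lerDl.
Qed.

End Approximable.

Section ApproximableModule.
Context {R : realType} {E F : normedModType R}.

Lemma approximableD (S T : 'L(E, F)) :
  approximable S -> approximable T -> approximable (S + T).
Proof.
move=> /approximableP Sa /approximableP Ta; apply/approximableP => e e0.
have e20 : 0 < e / 2 by rewrite divr_gt0.
have [S' S'f SS'] := Sa _ e20; have [T' T'f TT'] := Ta _ e20.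
exists (S' + T'); first exact: finite_rankD.
by rewrite opprD addrACA (le_trans (ler_normD _ _))// (splitr e) lerD.
Qed.

Lemma approximableZ (a : R) (T : 'L(E, F)) : approximable T -> approximable (a *: T).
Proof.
move=> /approximableP Ta; apply/approximableP => e e0.
have a0 : 0 < `|a| + 1 by rewrite ltr_wpDl.
have [T' T'f TT'] := Ta _ (divr_gt0 e0 a0).
exists (a *: T'); first exact: finite_rankZ.
rewrite -scalerBr normrZ (le_trans (ler_wpM2l _ TT'))// mulrCA ger_pMr//.
by rewrite ler_pdivrMr// mul1r lerDl.
Qed.

Lemma approximable_bigsum (I : Type) (s : seq I) (T : I -> 'L(E, F)) :
  (forall i, approximable (T i)) -> approximable (\sum_(i <- s) T i).
Proof.
move=> Ta; elim/big_ind: _ => //; last exact: approximableD.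
exact/approximable_finite_rank/finite_rank0.
Qed.

End ApproximableModule.

(** * Ultrafilters and bounded limits *)

Section Ultrafilters.

(** The device that satisfies infinitely many approximate conditions in the limit. Finite lists of
    conditions with a common tolerance form a filter base by monotonicity in [e], and any
    ultrafilter refining it realizes every condition at every tolerance. *)
Lemma ultra_conditions {R : realType} (I : Type) (C : eqType)
    (Q : C -> R -> set I) :
  (forall c e e', e <= e' -> Q c e `<=` Q c e') ->
  (forall (s : seq C) e, 0 < e -> exists i, forall c, c \in s -> Q c e i) ->
  exists2 U : set_system I, UltraFilter U & forall c e, 0 < e -> U (Q c e).
Proof.
move=> Qle Qne.
pose base (se : seq C * R) : set I := [set i | forall c, c \in se.1 -> Q c se.2 i].
pose F := filter_from [set se | 0 < se.2] base.
have FF : ProperFilter F.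
  apply: filter_from_proper; last by move=> [s e] /(Qne s).
  apply: filter_from_filter; first by exists ([::], 1) => /=.
  move=> [s e] [t f]/= e0 f0; exists (s ++ t, Num.min e f).
    by rewrite /= lt_min e0.
  by move=> i h; split=> c cs; apply: Qle (h c _);
    rewrite ?mem_cat ?cs ?orbT//= ge_min lexx ?orbT.
have [U [UU FU]] := ultraFilterLemma FF; exists U => // c e e0.
apply: FU; exists ([:: c], e) => //= i; apply; exact: mem_head.
Qed.

(** The limit is the supremum of the levels that [f] reaches on a set of [U]; an ultrafilter decides
    each level. *)
Lemma ultra_cvgR {R : realType} (I : Type) (U : set_system I) (f : I -> R) (K : R) :
  UltraFilter U -> U [set i | `|f i| <= K] -> exists l : R, f @ U --> l.
Proof.
move=> UU Uf; pose S := [set x : R | U [set i | x <= f i]].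
have S0 : S (- K).
  by apply: filterS Uf => i; rewrite /= ler_norml => /andP[].
have SK x : S x -> x <= K.
  move=> Sx; have [i [/= xi fi]] := filter_ex (filterI Sx Uf).
  by rewrite (le_trans xi)// (le_trans (ler_norm _)).
have supS : has_sup S by split; [exists (- K)|exists K => x /SK].
exists (sup S); apply/cvgrPdist_le => e e0.
have [x Sx xe] := sup_adherent e0 supS.
have Uup : U [set i | f i <= sup S + e].
  have [U1|] := in_ultra_setVsetC [set i | sup S + e <= f i] UU.
    have : sup S + e <= sup S by apply: ub_le_sup => //; case: supS.
    by rewrite gerDl leNgt e0.
  by apply: filterS => i /= /negP; rewrite -ltNge => /ltW.
apply: filterS (filterI Uup Sx) => i [/= fe xf].
rewrite ler_distl; apply/andP; split; last lra.
by have := le_trans (ltW xe) xf; lra.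
Qed.

End Ultrafilters.

(** * Finite averages and invariant means *)

Section Averages.
Context {R : realType}.

Definition avg {V : Type} {F : lmodType R} (B : seq V) (phi : V -> F) : F :=
  (size B)%:R^-1 *: \sum_(b <- B) phi b.

Lemma avgD {V : Type} {F : lmodType R} (B : seq V) (phi psi : V -> F) :
  avg B (fun x => phi x + psi x) = avg B phi + avg B psi.
Proof. by rewrite /avg big_split scalerDr. Qed.

Lemma avgB {V : Type} {F : lmodType R} (B : seq V) (phi psi : V -> F) :
  avg B (fun x => phi x - psi x) = avg B phi - avg B psi.
Proof. by rewrite /avg sumrB scalerBr. Qed.

Lemma avgZ {V : Type} {F : lmodType R} (B : seq V) (a : R) (phi : V -> F) :
  avg B (fun x => a *: phi x) = a *: avg B phi.
Proof. by rewrite /avg -scaler_sumr !scalerA mulrC. Qed.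

Lemma avg_cst {V : Type} {F : lmodType R} (B : seq V) (v : F) :
  (0 < size B)%N -> avg B (fun _ => v) = v.
Proof.
move=> B0; rewrite /avg big_const_seq count_predT iter_addr_0 -[v *+ _]scaler_nat.
by rewrite scalerA mulVf ?scale1r// pnatr_eq0 -lt0n.
Qed.

Lemma avg_norm_le {V : eqType} {F : normedModType R} (B : seq V) (phi : V -> F) (C : R) :
  0 <= C -> (forall x, x \in B -> `|phi x| <= C) -> `|avg B phi| <= C.
Proof.
move=> C0 phiC; have [/size0nil->|B0] := posnP (size B).
  by rewrite /avg big_nil scaler0 normr0.
rewrite normrZ ger0_norm ?invr_ge0// mulrC ler_pdivrMr ?ltr0n//.
rewrite (le_trans (ler_norm_sum _ _ _))//.
rewrite (@le_trans _ _ (\sum_(b <- B) C))//.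
  by rewrite big_seq [leRHS]big_seq; apply: ler_sum => b /phiC.
by rewrite big_const_seq count_predT iter_addr_0 -[C *+ _]mulr_natr.
Qed.

Lemma avg_ge {V : Type} (B : seq V) (phi : V -> R) (c : R) : (0 < size B)%N ->
  (forall x, c <= phi x) -> c <= avg B (phi : V -> R^o).
Proof.
move=> B0 h; rewrite -(@avg_cst _ R^o B c)//.
by rewrite /avg ler_wpM2l ?invr_ge0//; apply: ler_sum.
Qed.

(* Boxes [b + k y], [k < n], with [n] large, are almost invariant under the
   translation by [y]. *)
Lemma almost_invariant_average (V : zmodType) (Y : seq V) (e : R) : 0 < e ->
  exists2 B : seq V, (0 < size B)%N & forall (F : normedModType R) (phi : V -> F) (C : R),
    (forall x, `|phi x| <= C) -> forall y, y \in Y ->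
    `|avg B (fun x => phi (x + y)) - avg B phi| <= e * C.
Proof.
move=> e0; elim: Y => [|y Y [B B0 Binv]]; first by exists [:: 0].
(* Translating along [y] telescopes to two boundary averages of size at most [C], divided by the
   length [n]; hence [2 / e <= n]. *)
pose n := (Num.bound (2 / e)).+1.
have n0 : (0 : R) < n%:R by rewrite ltr0n.
pose B' := [seq b + y *+ k | k <- iota 0 n, b <- B].
have avgB' (F : normedModType R) (phi : V -> F) : avg B' phi =
    avg (iota 0 n) (fun k => avg B (fun b => phi (b + y *+ k))).
  rewrite /avg size_allpairs size_iota natrM invfM -scalerA big_allpairs_dep/=.
  by rewrite -scaler_sumr.
exists B' => [|F phi C phiC z]; first by rewrite size_allpairs size_iota muln_gt0.
have C0 : 0 <= C by rewrite (le_trans _ (phiC 0)).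
rewrite inE => /predU1P[->{z}|zY].
  rewrite !avgB' -avgB /avg size_iota normrZ ger0_norm ?invr_ge0 ?(ltW n0)//.
  rewrite ler_pdivrMl//.
  pose A k := avg B (fun b => phi (b + y *+ k)).
  have AC k : `|A k| <= C by apply: avg_norm_le => // b _.
  have -> : \sum_(k <- iota 0 n) ((size B)%:R^-1 *: (\sum_(b <- B) phi (b + y *+ k + y)) -
      (size B)%:R^-1 *: (\sum_(b <- B) phi (b + y *+ k))) = A n - A 0%N.
    rewrite -(telescope_sumr A (leq0n n)) /index_iota subn0.
    apply: eq_bigr => k _; congr (_ *: _ - _); apply: eq_bigr => b _.
    by rewrite mulrSr addrA.
  rewrite (le_trans (ler_normB _ _))// (le_trans (lerD (AC _) (AC _)))//.
  have : 2 / e <= n%:R.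
    have e20 : 0 <= 2 / e by rewrite divr_ge0// ltW.
    by rewrite (le_trans (ltW (archi_boundP e20)))// ler_nat.
  rewrite ler_pdivrMr// => en.
  by have := ler_wpM2r C0 en; lra.
(* For the earlier translations, the invariance of [B] is applied to the translates of [phi] by
   multiples of [y], which have the same bound [C]. *)
rewrite !avgB' -avgB; apply: avg_norm_le => [|k _].
  by rewrite mulr_ge0// ltW.
have := Binv _ (fun x => phi (x + y *+ k)) C (fun x => phiC _) z zY.
by congr (`|avg _ _ - _| <= _); apply/funext => b; rewrite addrAC.
Qed.

Definition bounded_fun {V : Type} (phi : V -> R) :=
  exists C : R, forall x, `|phi x| <= C.

(** Amenability of abelian groups: [M] is an ultrafilter limit of averages over finite families that
    become invariant under every translation. It is meaningful on bounded functions, where these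
    limits exist. *)
Lemma invariant_mean (V : zmodType) : exists M : (V -> R) -> R,
  [/\ forall phi psi, bounded_fun phi -> bounded_fun psi ->
        M (fun x => phi x + psi x) = M phi + M psi,
      forall a phi, bounded_fun phi -> M (fun x => a * phi x) = a * M phi,
      forall c phi, bounded_fun phi -> (forall x, c <= phi x) -> c <= M phi &
      forall y phi, bounded_fun phi -> M (fun x => phi (x + y)) = M phi].
Proof.
pose Q (y : V) (e : R) : set (seq V) := [set B | (0 < size B)%N /\
  forall (phi : V -> R^o) (C : R), (forall x, `|phi x| <= C) ->
    `|avg B (fun x => phi (x + y)) - avg B phi| <= e * C].
have [|s e /(almost_invariant_average s)[B B0 Binv]|U UU UQ] := @ultra_conditions R (seq V) V Q.
- move=> y e e' ee' B [B0 h]; split=> // phi C phiC.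
  rewrite (le_trans (h _ _ phiC))// ler_wpM2r//.
  by rewrite (le_trans _ (phiC 0)).
- by exists B => y ys; split=> // phi C phiC; exact: Binv.
have UB0 : U [set B | (0 < size B)%N].
  by apply: filterS (UQ 0 1 ltr01) => B [].
pose A (phi : V -> R) (B : seq V) : R := @avg V R^o B phi.
pose M (phi : V -> R) : R := lim (A phi @ U).
have Mcvg phi : bounded_fun phi -> A phi @ U --> M phi.
  move=> [C phiC]; have C0 : 0 <= C by rewrite (le_trans _ (phiC 0)).
  have [l Ul] := @ultra_cvgR R _ U (A phi) C UU
    (filterE _ (fun B => avg_norm_le C0 (fun x _ => phiC x))).
  by rewrite /M (cvg_lim _ Ul).
have uniq (l l' : R) (f : seq V -> R) : f @ U --> l -> f @ U --> l' -> l = l'.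
  exact: cvg_unique.
exists M; split.
- move=> phi psi bphi bpsi; apply/esym; apply: (uniq _ _ _ (cvgD (Mcvg _ bphi) (Mcvg _ bpsi))).
  rewrite (_ : _ + _ = A (fun x => phi x + psi x)).
    apply: Mcvg; have [[C phiC] [D psiD]] := (bphi, bpsi).
    by exists (C + D) => x; rewrite (le_trans (ler_normD _ _))// lerD.
  by apply/funext => B; apply/esym; exact: (@avgD V R^o B phi psi).
- move=> a phi bphi; apply/esym; apply: (uniq _ _ _ (@cvgMl_tmp _ _ _ _ _ a _ (Mcvg _ bphi))).
  rewrite (_ : (fun x => _) = A (fun x => a * phi x)).
    apply: Mcvg; have [C phiC] := bphi.
    by exists (`|a| * C) => x; rewrite normrM ler_wpM2l.
  by apply/funext => B; apply/esym; exact: (@avgZ V R^o B a phi).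
- move=> c phi bphi cphi; apply: (cvgr_to_ge (Mcvg _ bphi)).
  by apply: filterS UB0 => B B0; exact: avg_ge.
- move=> y phi bphi.
  have bphiy : bounded_fun (fun x => phi (x + y)).
    by have [C phiC] := bphi; exists C => x.
  apply/eqP; rewrite -subr_eq0; apply/eqP.
  apply: (uniq _ _ _ (cvgB (Mcvg _ bphiy) (Mcvg _ bphi))).
  have [C phiC] := bphi; have C0 : 0 <= C by rewrite (le_trans _ (phiC 0)).
  apply/cvgrPdist_le => e e0.
  have C10 : 0 < C + 1 by rewrite ltr_wpDl.
  apply: filterS (UQ y (e / (C + 1)) (divr_gt0 e0 C10)) => B [_ h].
  rewrite sub0r normrN (le_trans (h _ _ phiC))// mulrAC ler_pdivrMr//.
  by rewrite ler_wpM2l ?(ltW e0)// lerDl.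
Qed.

End Averages.

(** * Coarse differentiation *)

Section CoarseDifferentiation.
Context {R : realType} {E : normedModType R}.
Implicit Types (phi : E -> R) (v p : E) (t : R).

Let bounded_funD (f g : E -> R) : bounded_fun f -> bounded_fun g ->
  bounded_fun (fun p => f p + g p).
Proof.
move=> [C fC] [D gD]; exists (C + D) => p.
by rewrite (le_trans (ler_normD _ _))// lerD.
Qed.

Let bounded_funZ (a : R) (f : E -> R) : bounded_fun f ->
  bounded_fun (fun p => a * f p).
Proof. by move=> [C fC]; exists (`|a| * C) => p; rewrite normrM ler_wpM2l. Qed.

Let bounded_fun_shift (f : E -> R) v : bounded_fun f ->
  bounded_fun (fun p => f (p + v)).
Proof. by move=> [C fC]; exists C. Qed.

Let bounded_fun_sqr (f : E -> R) : bounded_fun f -> bounded_fun (fun p => f p ^+ 2).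
Proof.
by move=> [C fC]; exists (C ^+ 2) => p; rewrite normrX lerXn2r// nnegrE (le_trans _ (fC p)).
Qed.

Let incr phi v t p : R := phi (p + t *: v) - phi p.

Let incr2 phi v t p : R := phi (p + (2 * t) *: v) - 2 * phi (p + t *: v) + phi p.

Let additivity_defect phi x y t p : R :=
  phi (p + t *: (x + y)) - phi (p + t *: x) - phi (p + t *: y) + phi p.

Let incr_bound phi (K : R) v t p : (forall p q, `|phi p - phi q| <= K * `|p - q|) ->
  `|incr phi v t p| <= K * `|t *: v|.
Proof. by move=> phiK; rewrite (le_trans (phiK _ _))// addrAC subrr add0r. Qed.

(* By the parallelogram identity, the mean square of the slope at scale [t]
   exceeds the one at scale [2 t] by the mean square of the second difference.
   Being monotone and bounded, these energies are almost constant between two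
   suitable consecutive dyadic scales, where all second differences are therefore
   small on average. *)
Lemma coarse_differentiability (I : eqType) (s : seq I) (phi : I -> E -> R)
    (K : I -> R) (x y : I -> E) (e : R) : 0 < e ->
  (forall i p q, `|phi i p - phi i q| <= K i * `|p - q|) ->
  exists p t, 0 < t /\ forall i, i \in s ->
    `|phi i (p + t *: (x i + y i)) - phi i (p + t *: x i) - phi i (p + t *: y i) + phi i p|
      <= e * t.
Proof.
move=> e0 phiK; have [M [MD MZ Mge Mshift]] := @invariant_mean R E.
have bincr i v t : bounded_fun (incr (phi i) v t).
  by exists (K i * `|t *: v|) => p; exact: incr_bound.
have binc2 i v t : bounded_fun (fun p => incr (phi i) v t p ^+ 2).
  exact/bounded_fun_sqr/bincr.
have M0 : M (fun _ => 0) = 0.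
  have b0 : bounded_fun (fun _ : E => 0 : R) by exists 0 => p; rewrite normr0.
  rewrite -[RHS](mul0r (M (fun _ => 0))) -(MZ 0 _ b0).
  by congr M; apply/funext => p; rewrite mul0r.
have Msum (J : Type) (r : seq J) (g : J -> E -> R) : (forall j, bounded_fun (g j)) ->
    bounded_fun (fun p => \sum_(j <- r) g j p) /\
    M (fun p => \sum_(j <- r) g j p) = \sum_(j <- r) M (g j).
  move=> bg; elim: r => [|j r [br IH]].
    rewrite big_nil -[RHS]M0; split; last by congr M; apply/funext => p; rewrite big_nil.
    by exists 0 => p; rewrite big_nil normr0.
  have -> : (fun p => \sum_(i <- j :: r) g i p) = fun p => g j p + \sum_(i <- r) g i p.
    by apply/funext => p; rewrite big_cons.
  by split; [exact: bounded_funD|rewrite big_cons MD// IH].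
have Mle f g : bounded_fun f -> bounded_fun g -> (forall p, f p <= g p) -> M f <= M g.
  move=> bf bg fg.
  have bNf := bounded_funZ (-1) bf.
  have : 0 <= M (fun p => g p + -1 * f p).
    by apply: Mge => [|p]; [exact: bounded_funD|rewrite mulN1r subr_ge0].
  by rewrite MD// MZ// mulN1r subr_ge0.
have Mcst (c : R) : M (fun _ => c) = c.
  have bc (d : R) : bounded_fun (fun _ : E => d) by exists `|d|.
  apply/eqP; rewrite eq_le (Mge _ _ (bc c))// andbT.
  have : - c <= M (fun _ => -1 * c) by apply: Mge => // _; rewrite mulN1r.
  by rewrite (MZ (-1) (fun _ => c))// mulN1r lerN2.
pose en i v t := M (fun p => incr (phi i) v t p ^+ 2) / t ^+ 2.
have en_ge0 i v t : 0 <= en i v t.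
  rewrite /en mulr_ge0 ?invr_ge0 ?sqr_ge0//.
  by apply: Mge => // p; rewrite sqr_ge0.
have en_le i v t : 0 < t -> en i v t <= (K i * `|v|) ^+ 2.
  move=> t0; rewrite ler_pdivrMr ?exprn_gt0// -exprMn.
  rewrite -(Mcst (_ ^+ 2)); apply: Mle => // [|p].
    by exists `|(K i * `|v| * t) ^+ 2|.
  have Kt : `|incr (phi i) v t p| <= K i * `|v| * t.
    by rewrite (le_trans (incr_bound v t p (phiK i)))// normrZ (gtr0_norm t0) mulrA mulrAC.
  rewrite -real_normK ?num_real// lerXn2r// nnegrE.
  exact: le_trans Kt.
have binc22 i v t : bounded_fun (fun p => incr2 (phi i) v t p ^+ 2).
  apply: bounded_fun_sqr.
  have -> : incr2 (phi i) v t = fun p => incr (phi i) v t (p + t *: v) + -1 * incr (phi i) v t p.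
    apply/funext => p; rewrite /incr2 /incr mulr_natl mulr2n scalerDl addrA; ring.
  apply: bounded_funD; last exact: bounded_funZ.
  exact/bounded_fun_shift.
(* The second difference is the difference of two consecutive increments, and invariance of [M]
   gives these two the same mean square. *)
have en_incr i v t : 0 < t ->
    M (fun p => incr2 (phi i) v t p ^+ 2) = 4 * t ^+ 2 * (en i v t - en i v (2 * t)).
  move=> t0.
  have -> : (fun p => incr2 (phi i) v t p ^+ 2) = fun p =>
      (2 * incr (phi i) v t (p + t *: v) ^+ 2 + 2 * incr (phi i) v t p ^+ 2) +
      -1 * incr (phi i) v (2 * t) p ^+ 2.
    apply/funext => p; rewrite /incr2 /incr mulr_natl mulr2n scalerDl addrA; ring.
  have bsh : bounded_fun (fun p => incr (phi i) v t (p + t *: v) ^+ 2).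
    exact: (bounded_fun_shift (t *: v) (binc2 i v t)).
  rewrite MD; [|by apply: bounded_funD; exact: bounded_funZ|exact: bounded_funZ].
  rewrite MD; [|exact: bounded_funZ|exact: bounded_funZ].
  rewrite !MZ// (Mshift (t *: v) (fun p => incr (phi i) v t p ^+ 2))// /en.
  by field; rewrite gt_eqF.
(* Three directions are controlled because the additivity defect for [x] and [y] is a combination of
   second differences along [x], [y] and [x - y]. *)
pose S j := \sum_(i <- s) (en i (x i) (2^-1 ^+ j) + en i (y i) (2^-1 ^+ j)
  + en i (x i - y i) (2^-1 ^+ j)).
pose B := \sum_(i <- s) ((K i * `|x i|) ^+ 2 + (K i * `|y i|) ^+ 2
  + (K i * `|x i - y i|) ^+ 2).
have S_ge0 j : 0 <= S j by apply: sumr_ge0 => i _; rewrite !addr_ge0.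
have SB j : S j <= B.
  have tj : (0 : R) < 2^-1 ^+ j by rewrite exprn_gt0.
  by apply: ler_sum => i _; rewrite !lerD// en_le.
(* The mean of the summed squared defects will be at most [3 t^2 d]; with this [d] it is strictly
   below [(e t)^2], so some point does as well. *)
pose d := e ^+ 2 / 4.
have d0 : 0 < d by rewrite divr_gt0 ?exprn_gt0.
have [j Sj] : exists j, S j.+1 - S j <= d.
  apply: contrapT => /forallNP h.
  have Sn n : n%:R * d <= S n.
    elim: n => [|n IH]; first by rewrite mul0r.
    have /negP := h n; rewrite -ltNge => hn.
    by rewrite -natr1 mulrDl mul1r; lra.
  have := le_trans (Sn (Num.bound (B / d))) (SB _).
  rewrite -ler_pdivlMr// leNgt; apply/negP/negPn.
  by apply: archi_boundP; rewrite divr_ge0 ?(ltW d0)// (le_trans (S_ge0 0%N)).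
pose t : R := 2^-1 ^+ j.+1.
have t0 : 0 < t by rewrite exprn_gt0.
have t2 : 2 * t = 2^-1 ^+ j by rewrite /t exprS mulrA divff ?mul1r// pnatr_eq0.
pose X i := additivity_defect (phi i) (x i) (y i) t.
pose D i v := incr2 (phi i) v t.
(* Based at [p + 2 t y], the second difference along [x - y] has midpoint [p + t (x + y)], and its
   end points cancel the far points of the other two. *)
have XE i p : X i p =
    2^-1 * (D i (x i) p + D i (y i) p - D i (x i - y i) (p + (2 * t) *: y i)).
  rewrite /X /D /additivity_defect /incr2.
  have -> : p + (2 * t) *: y i + (2 * t) *: (x i - y i) = p + (2 * t) *: x i.
    by rewrite -addrA -scalerDr [y i + _]addrC subrK.
  have -> : p + (2 * t) *: y i + t *: (x i - y i) = p + t *: (x i + y i).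
    rewrite -addrA; congr (_ + _); rewrite mulr_natl mulr2n scalerDl -addrA -scalerDr.
    by rewrite [y i + _]addrC subrK -scalerDr addrC.
  by field.
have bDs i v w : bounded_fun (fun p => D i v (p + w) ^+ 2).
  exact: (bounded_fun_shift w (binc22 i v t)).
have bX2 i : bounded_fun (fun p => X i p ^+ 2).
  apply: bounded_fun_sqr.
  have -> : X i = fun p => incr (phi i) (x i) t (p + t *: y i) + -1 * incr (phi i) (x i) t p.
    apply/funext => p; rewrite /X /additivity_defect /incr scalerDr.
    rewrite [t *: x i + _]addrC addrA; ring.
  by apply: bounded_funD; [exact/bounded_fun_shift|exact: bounded_funZ].
(* From [(a + b - c)^2 <= 3 (a^2 + b^2 + c^2)]; the factor [1 / 4] of the squared half in [XE]
   cancels the [4] in [en_incr]. *)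
have MX i : M (fun p => X i p ^+ 2) <= 3 * t ^+ 2 *
    ((en i (x i) t + en i (y i) t + en i (x i - y i) t) -
     (en i (x i) (2 * t) + en i (y i) (2 * t) + en i (x i - y i) (2 * t))).
  pose g p := 3 / 4 * (D i (x i) p ^+ 2 + D i (y i) p ^+ 2 +
    D i (x i - y i) (p + (2 * t) *: y i) ^+ 2).
  have b1 : bounded_fun (fun p => D i (x i) p ^+ 2 + D i (y i) p ^+ 2).
    by apply: bounded_funD; exact: binc22.
  have b2 := bounded_funD b1 (bDs i (x i - y i) ((2 * t) *: y i)).
  rewrite (@le_trans _ _ (M g))//.
    apply: Mle => // [|p]; first exact: bounded_funZ.
    rewrite XE /g; set a := D _ _ _; set b := D _ _ _; set c := D _ _ _.
    have := sqr_ge0 (a - b); have := sqr_ge0 (a + c); have := sqr_ge0 (b + c).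
    rewrite !expr2; lra.
  rewrite /g MZ// MD// MD//; try exact: binc22.
  rewrite (Mshift _ (fun p => D i (x i - y i) p ^+ 2)); last exact: binc22.
  rewrite /D !en_incr// le_eqVlt; apply/orP; left; apply/eqP; by field.
have [bXs MXs] := Msum _ s (fun i p => X i p ^+ 2) bX2.
have MXd : M (fun p => \sum_(i <- s) X i p ^+ 2) <= 3 * t ^+ 2 * d.
  rewrite MXs (le_trans (ler_sum _ (fun i _ => MX i)))//.
  rewrite -mulr_sumr ler_wpM2l//; first by rewrite mulr_ge0 ?sqr_ge0.
  by rewrite sumrB t2.
have [p Xp] : exists p, \sum_(i <- s) X i p ^+ 2 < (e * t) ^+ 2.
  apply: contrapT => /forallNP h.
  have : (e * t) ^+ 2 <= 3 * t ^+ 2 * d.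
    by rewrite (le_trans _ MXd)//; apply: Mge => // p; rewrite leNgt; apply/negP/h.
  have : 0 < e ^+ 2 * t ^+ 2 by rewrite mulr_gt0 ?exprn_gt0.
  rewrite /d exprMn; lra.
exists p, t; split=> // i si.
have : X i p ^+ 2 < (e * t) ^+ 2.
  rewrite (le_lt_trans _ Xp)// (big_rem i)//= lerDl.
  by apply: sumr_ge0 => k _; exact: sqr_ge0.
rewrite -(real_normK (num_real (X i p))) ltr_pXn2r ?nnegrE ?mulr_ge0 ?(ltW e0) ?(ltW t0)//.
exact: ltW.
Qed.

End CoarseDifferentiation.

(** * Errors that vanish along a filter *)

Section SmallAlongFilter.
Context {R : realType} {I : Type} {U : set_system I} {FU : ProperFilter U}.

Definition small {F : normedModType R} (f : I -> F) : Prop :=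
  forall e : R, 0 < e -> U [set i | `|f i| <= e].

Lemma small_ext {F : normedModType R} (f g : I -> F) : f =1 g -> small f -> small g.
Proof. by move=> /funext ->. Qed.

Lemma smallD {F : normedModType R} (f g : I -> F) : small f -> small g ->
  small (fun i => f i + g i).
Proof.
move=> sf sg e e0; have e20 : 0 < e / 2 by rewrite divr_gt0.
apply: filterS (filterI (sf _ e20) (sg _ e20)) => i [/= fi gi].
by rewrite (le_trans (ler_normD _ _))// (splitr e) lerD.
Qed.

Lemma smallN {F : normedModType R} (f : I -> F) : small f -> small (fun i => - f i).
Proof. by move=> sf e /sf; apply: filterS => i /=; rewrite normrN. Qed.

Lemma smallB {F : normedModType R} (f g : I -> F) : small f -> small g ->
  small (fun i => f i - g i).
Proof. by move=> sf sg; apply: smallD => //; exact: smallN. Qed.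

Lemma small_dominated {F G : normedModType R} (K : R) (f : I -> F) (g : I -> G) :
  small g -> U [set i | `|f i| <= K * `|g i|] -> small f.
Proof.
move=> sg fg e e0; have K1 : 0 < `|K| + 1 by rewrite ltr_wpDl.
apply: filterS (filterI fg (sg _ (divr_gt0 e0 K1))) => i [/= fi gi].
rewrite (le_trans fi)// (@le_trans _ _ (`|K| * `|g i|))//.
  by rewrite ler_wpM2r// ler_norm.
rewrite (le_trans (ler_wpM2l _ gi))// mulrCA ger_pMr// ler_pdivrMr// mul1r.
by rewrite lerDl.
Qed.

Lemma smallZr {F : normedModType R} (c : I -> R^o) (v : F) : small c ->
  small (fun i => (c i : R) *: v).
Proof.
move=> sc; apply: (small_dominated (K := `|v|) sc).
by apply: filterE => i /=; rewrite normrZ mulrC.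
Qed.

Lemma small_sum {F : normedModType R} (J : Type) (s : seq J) (f : J -> I -> F) :
  (forall j, small (f j)) -> small (fun i => \sum_(j <- s) f j i).
Proof.
move=> sf; elim: s => [|j s IH].
  by move=> e e0; apply: filterE => i /=; rewrite big_nil normr0 ltW.
have := smallD (sf j) IH.
by congr small; apply/funext => i; rewrite big_cons.
Qed.

Lemma small_uniq {F : normedModType R} (x : F) : small (fun _ => x) -> x = 0.
Proof.
move=> sx; apply/eqP; rewrite -normr_le0; apply/ler_addgt0Pr => e e0.
by rewrite add0r; have [i] := filter_ex (sx e e0).
Qed.

Lemma small_trans {F : normedModType R} (f g h : I -> F) :
  small (fun i => f i - g i) -> small (fun i => g i - h i) ->
  small (fun i => f i - h i).
Proof.
move=> fg gh; have := smallD fg gh; congr small; apply/funext => i.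
by rewrite subrKA.
Qed.

Lemma cvg_small (f : I -> R) (l : R) : f @ U --> l <-> small (fun i => f i - l : R^o).
Proof.
split=> [/cvgrPdist_le h e /h|h].
  by apply: filterS => i /=; rewrite distrC.
by apply/cvgrPdist_le => e /h; apply: filterS => i /=; rewrite distrC.
Qed.

(** Cauchy's functional equation up to vanishing errors: additivity gives natural and then rational
    factors, the uniform Lipschitz bound gives nonnegative real ones, and [q i 0 = 0] gives the
    sign. *)
Lemma asymptotic_homogeneity {E F : normedModType R} (q : I -> E -> F) (K : R) :
  0 <= K ->
  U [set i | forall x y, `|q i x - q i y| <= K * `|x - y|] ->
  U [set i | q i 0 = 0] ->
  (forall x y, small (fun i => q i (x + y) - q i x - q i y)) ->
  forall (c : R) x, small (fun i => q i (c *: x) - c *: q i x).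
Proof.
move=> K0 qK q0 qD.
have qn n x : small (fun i => q i (n%:R *: x) - n%:R *: q i x).
  elim: n => [|n IH].
    move=> e e0; apply: filterS q0 => i /= qi0.
    by rewrite !scale0r qi0 subrr normr0 ltW.
  apply: (small_trans (g := fun i => q i (n%:R *: x) + q i x)).
    have := qD (n%:R *: x) x; congr small; apply/funext => i.
    by rewrite -natr1 scalerDl scale1r opprD addrA.
  move: IH; congr small; apply/funext => i.
  by rewrite -natr1 scalerDl scale1r opprD addrACA subrr addr0.
have qrat n N x : small (fun i => q i ((n%:R / N.+1%:R) *: x) - (n%:R / N.+1%:R) *: q i x).
  have N0 : N.+1%:R != 0 :> R by rewrite pnatr_eq0.
  pose y := N.+1%:R^-1 *: x.
  apply: (small_trans (g := fun i => n%:R *: q i y)).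
    by have := qn n y; rewrite scalerA.
  apply: (small_dominated (K := n%:R / N.+1%:R) (qn N.+1 y)).
  apply: filterE => i /=.
  have -> : n%:R *: q i y - (n%:R / N.+1%:R) *: q i x =
      - ((n%:R / N.+1%:R) *: (q i (N.+1%:R *: y) - N.+1%:R *: q i y)).
    by rewrite /y scalerA divff// scale1r scalerBr scalerA divfK// opprB.
  by rewrite normrN normrZ ger0_norm.
have qpos (c : R) x : 0 <= c -> small (fun i => q i (c *: x) - c *: q i x).
  move=> c0 e e0; have e20 : 0 < e / 2 by rewrite divr_gt0.
  (* [n / N.+1] is the multiple of [1 / N.+1] just below [c]. Replacing [c] by it costs at most
     [K |x| / N.+1] in each of the two terms, hence the [2]. *)
  pose C := 2 * (K * `|x|); have C0 : 0 <= C by rewrite !mulr_ge0.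
  pose N := Num.bound (C / (e / 2)); pose n := Num.trunc (c * N.+1%:R).
  have N0 : (0 : R) < N.+1%:R by rewrite ltr0n.
  have cn : `|c - n%:R / N.+1%:R| <= N.+1%:R^-1.
    have := truncn_itv (mulr_ge0 c0 (ltW N0)); rewrite -/n => /andP[n1 n2].
    rewrite -(ler_pM2r N0) mulVf ?gt_eqF// -{2}(gtr0_norm N0) -normrM mulrBl.
    rewrite divfK ?gt_eqF// ger0_norm ?subr_ge0//.
    by move: n2; rewrite -natr1; lra.
  have CN : C * N.+1%:R^-1 <= e / 2.
    rewrite ler_pdivrMr// mulrC -ler_pdivrMr//.
    have := archi_boundP (divr_ge0 C0 (ltW e20)); rewrite -/N => /ltW/le_trans; apply.
    by rewrite ler_nat.
  apply: filterS (filterI (filterI qK q0) (qrat n N x _ e20)) => i [[/= qiK qi0]] h.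
  rewrite -(subrKA (q i ((n%:R / N.+1%:R) *: x))).
  rewrite -[X in _ + X](subrKA ((n%:R / N.+1%:R) *: q i x)).
  rewrite (le_trans (ler_normD _ _))// (le_trans (lerD (lexx _) (ler_normD _ _)))//.
  have h1 : `|q i (c *: x) - q i ((n%:R / N.+1%:R) *: x)| <= N.+1%:R^-1 * (K * `|x|).
    rewrite (le_trans (qiK _ _))// -scalerBl normrZ mulrCA ler_wpM2r//.
    exact: mulr_ge0.
  have h2 : `|(n%:R / N.+1%:R) *: q i x - c *: q i x| <= N.+1%:R^-1 * (K * `|x|).
    rewrite -scalerBl normrZ distrC ler_pM//.
    by have := qiK x 0; rewrite qi0 !subr0.
  move: h h1 h2 CN; rewrite /C /=; move: N.+1%:R^-1 => m; lra.
move=> c x; have [c0|/ltW c0] := leP 0 c; first exact: qpos.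
have Nc0 : 0 <= - c by rewrite oppr_ge0.
apply: (small_trans (g := fun i => - q i ((- c) *: x))).
  move=> e e0; apply: filterS (filterI q0 (qD (c *: x) ((- c) *: x) e e0)) => i /= [qi0].
  move=> h; rewrite opprK -normrN opprD; move: h.
  by rewrite -scalerDl subrr scale0r qi0 sub0r.
have := smallN (qpos (- c) x Nc0); congr small; apply/funext => i.
by rewrite opprB addrC (scaleNr c (q i x)).
Qed.

End SmallAlongFilter.

(** * Weak-star limits of asymptotically linear maps *)

Section WeakLimits.
Context {R : realType}.
Implicit Types E F G X Y : normedModType R.

Lemma bounded_linear_of E F (f : E -> F) (K : R) : 
  (forall x y, f (x + y) = f x + f y) -> (forall (a : R) x, f (a *: x) = a *: f x) ->
  (forall x, `|f x| <= K * `|x|) -> bounded_linear f.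
Proof. by move=> fD fZ fK; split; [move=> a x y; rewrite fD fZ|exists K]. Qed.

(** Banach-Alaoglu by hand: each pairing with [g] is bounded, hence converges along the ultrafilter,
    and additivity of the limit only requires the defects to vanish after testing on [g]. *)
Lemma weak_limit E F G (I : Type) (U : set_system I) (UU : UltraFilter U)
    (q : I -> E -> F) (K : R) (iota : 'L(F, dual G)) :
  0 <= K ->
  U [set i | forall x y, `|q i x - q i y| <= K * `|x - y|] ->
  U [set i | q i 0 = 0] ->
  (forall x y g, small (U := U)
    (fun i => <[iota (q i (x + y) - q i x - q i y), g]> : R^o)) ->
  exists2 L : 'L(E, dual G), `|L| <= K * `|iota| &
    forall x g, small (U := U) (fun i => <[iota (q i x), g]> - <[L x, g]> : R^o).
Proof.
move=> K0 qK q0 qD.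
have qx : U [set i | forall x, `|q i x| <= K * `|x|].
  apply: filterS (filterI qK q0) => i [/= qi qi0] x.
  by have := qi x 0; rewrite qi0 !subr0.
have iq x g i : `|q i x| <= K * `|x| -> `|<[iota (q i x), g]>| <= K * `|iota| * `|x| * `|g|.
  move=> qix; rewrite (le_trans (ler_pairing _ _))// ler_wpM2r//.
  by rewrite (le_trans (ler_blop _ _))// mulrAC [leRHS]mulrC ler_wpM2l.
have limP x g : exists l : R, small (U := U) (fun i => <[iota (q i x), g]> - l : R^o).
  have [|l /cvg_small] := @ultra_cvgR R I U (fun i => <[iota (q i x), g]>)
    (K * `|iota| * `|x| * `|g|) UU; last by exists l.
  by apply: filterS qx => i /= /(_ x); exact: iq.
have [l lP] := choice (fun xg => limP xg.1 xg.2).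
have lbound x g : `|l (x, g)| <= K * `|iota| * `|x| * `|g|.
  apply/ler_addgt0Pr => e e0.
  have [i [/= qix li]] := filter_ex (filterI qx (lP (x, g) e e0)).
  rewrite -(subKr <[iota (q i x), g]> (l (x, g))) (le_trans (ler_normB _ _))//.
  by rewrite lerD// iq.
have uniq x g (a : R) : small (U := U) (fun i => <[iota (q i x), g]> - a : R^o) -> l (x, g) = a.
  move=> ha; apply/eqP; rewrite -subr_eq0; apply/eqP.
  apply: (@small_uniq _ _ U _ R^o); apply: small_ext (smallB ha (lP (x, g))) => i /=; ring.
have lg x : bounded_linear (fun g => l (x, g) : R^o).
  apply: (@bounded_linear_of _ _ _ (K * `|iota| * `|x|)) => [g h|a g|g]; last exact: lbound.
  - apply: uniq; apply: small_ext (smallD (lP (x, g)) (lP (x, h))) => i /=.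
    by rewrite pairingD; ring.
  - apply: uniq; apply: (small_dominated (K := `|a|) (lP (x, g))).
    apply: filterE => i /=; rewrite pairingZ -normrM mulrBr.
    exact: lexx.
pose Lx x : dual G := mkblop (lg x).
have Lbd : bounded_linear Lx.
  apply: (@bounded_linear_of _ _ _ (K * `|iota|)) => [x y|a x|x].
  - apply: blop_eqP => g; change (l (x + y, g) = l (x, g) + l (y, g)); apply: uniq.
    apply: small_ext (smallD (qD x y g) (smallD (lP (x, g)) (lP (y, g)))) => i /=.
    by rewrite !linearB !pairingBl /=; ring.
  - apply: blop_eqP => g; change (l (a *: x, g) = a * l (x, g)); apply: uniq.
    (* Homogeneity is derived for the scalar maps obtained by testing on [g], since only their
       defects are known to vanish. *)
    have qh : small (U := U) (fun i => <[iota (q i (a *: x)), g]> - a *: <[iota (q i x), g]> : R^o).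
      apply: (@asymptotic_homogeneity R I U _ E R^o (fun i x => <[iota (q i x), g]>)
        (K * `|iota| * `|g|)).
      - by rewrite !mulr_ge0.
      - apply: filterS qK => i /= qi z y.
        have -> : <[iota (q i z), g]> - <[iota (q i y), g]> = <[iota (q i z - q i y), g]>.
          by rewrite linearB.
        rewrite (le_trans (ler_pairing _ _))// mulrAC ler_wpM2r//.
        by rewrite (le_trans (ler_blop _ _))// mulrAC [leRHS]mulrC ler_wpM2l.
      - by apply: filterS q0 => i /= ->; rewrite linear0.
      - move=> z y; apply: small_ext (qD z y g) => i.
        by rewrite !linearB.
    apply: (small_trans qh).
    apply: (small_dominated (K := `|a|) (lP (x, g))).
    apply: filterE => i /=; rewrite -normrM mulrBr.
    exact: lexx.
  - apply: blop_norm_le => [|g]; first by rewrite !mulr_ge0.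
    exact: lbound.
exists (mkblop Lbd).
  apply: blop_norm_le => [|x]; first exact: mulr_ge0.
  apply: blop_norm_le => [|g]; first by rewrite !mulr_ge0.
  exact: lbound.
by move=> x g; exact: (lP (x, g)).
Qed.

Lemma complete_seq (X : completeNormedModType R) (u : nat -> X) :
  (forall n m, `|u n - u m| <= n.+1%:R^-1 + m.+1%:R^-1) ->
  exists l, forall n, `|u n - l| <= n.+1%:R^-1.
Proof.
move=> uc.
have ucvg : cvg (u @ \oo).
  apply: cauchy_cvg; apply/cauchy_ballP => e e0.
  have e20 : 0 < e / 2 by rewrite divr_gt0.
  have [N _ hN] := near_infty_natSinv_lt (PosNum e20).
  exists ([set u n | n in [set n | (N <= n)%N]], [set u n | n in [set n | (N <= n)%N]]).
    by split; exists N => // n Nn; exists n.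
  move=> [_ _]/= [[n Nn <-] [m Nm <-]]; rewrite -ball_normE/=.
  by rewrite (le_lt_trans (uc _ _))// (splitr e) ltrD//; exact: hN.
exists (lim (u @ \oo)) => n; apply/ler_addgt0Pr => e e0.
have e20 : 0 < e / 2 by rewrite divr_gt0.
have [N _ hN] := near_infty_natSinv_lt (PosNum e20).
have /cvgrPdist_le/(_ _ e20)[M _ hM] := ucvg.
pose m := maxn N M.
rewrite -(subrKA (u m)) (le_trans (ler_normD _ _))//.
have hN' : m.+1%:R^-1 < e / 2 := hN m (leq_maxl _ _).
have : `|lim (u @ \oo) - u m| <= e / 2 := hM m (leq_maxr _ _).
by rewrite distrC; move: (uc n m) hN'; move: m.+1%:R^-1 n.+1%:R^-1 => a b; lra.
Qed.

End WeakLimits.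

(** * Extension of approximable operators to the bidual *)

Section BidualExtension.
Context {R : realType}.
Implicit Types X Y : normedModType R.

Lemma pairing_sumr Y (eta : dual Y) (I : Type) (s : seq I) (v : I -> Y) :
  <[eta, \sum_(i <- s) v i]> = \sum_(i <- s) <[eta, v i]> :> R.
Proof. exact: linear_sum. Qed.

Lemma pairing_suml Y (I : Type) (s : seq I) (eta : I -> dual Y) y :
  <[\sum_(i <- s) eta i : dual Y, y]> = \sum_(i <- s) <[eta i, y]> :> R.
Proof. exact: (@blop_sumE _ Y R^o). Qed.

Definition pullback X Y (eta : dual Y) (T : 'L(X, Y)) : dual X :=
  (eta : 'L(Y, R^o)) \oL T.

Lemma pullback_norm X Y (eta : dual Y) (T : 'L(X, Y)) : `|pullback eta T| <= `|eta| * `|T|.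
Proof. exact: blop_comp_norm. Qed.

(** [Tt] is the second adjoint of [T], with values in [Y] rather than in its bidual. *)
Definition extends_to_bidual X Y (T : 'L(X, Y)) (Tt : 'L(dual (dual X), Y)) : Prop :=
  forall theta (eta : dual Y), <[eta, Tt theta]> = <[theta, pullback eta T]>.

Lemma bidual_extension_dist X Y (S T : 'L(X, Y)) St Tt :
  extends_to_bidual S St -> extends_to_bidual T Tt -> `|St - Tt| <= `|S - T|.
Proof.
move=> hS hT; apply: blop_norm_le_dual => // theta eta eta1.
rewrite (_ : <[eta, _]> = <[theta, pullback eta (S - T)]>).
  rewrite (le_trans (ler_norm _))// (le_trans (ler_pairing _ _))// mulrC.
  rewrite ler_wpM2r// (le_trans (pullback_norm _ _))// ler_piMl//.
rewrite [(St - Tt) theta]/(St theta - Tt theta) pairingB hS hT -pairingB.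
by congr (_ _); apply/blop_eqP => x; rewrite /= [RHS]pairingB.
Qed.

Lemma finite_rank_bidual_extension X Y (T : 'L(X, Y)) : finite_rank T ->
  exists2 Tt, extends_to_bidual T Tt & finite_rank Tt.
Proof.
move=> /finite_rank_repr[s sT].
exists (\sum_(i <- s) rank1 (bidual_inclusion _ (pullback i.2 T)) (T i.1)); last first.
  by apply: finite_rank_bigsum => i; exact: finite_rank_rank1.
move=> theta eta; rewrite blop_sumE pairing_sumr.
have -> : pullback eta T = \sum_(i <- s) <[eta, T i.1]> *: pullback i.2 T.
  apply/blop_eqP => x; rewrite [RHS]pairing_suml/= {1}sT pairing_sumr.
  by apply: eq_bigr => i _; rewrite pairingZ mulrC.
by rewrite pairing_sumr; apply: eq_bigr => i _; rewrite !pairingZ mulrC.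
Qed.

(** The second adjoint of a finite rank operator has values in [Y], and passing to it does not
    increase distances; extensions of finite rank approximations therefore converge, [Y] being
    complete. *)
Lemma approximable_bidual_extension X (Y : completeNormedModType R) (T : 'L(X, Y)) :
  approximable T ->
  exists Tt, [/\ extends_to_bidual T Tt, approximable Tt & `|Tt| <= `|T|].
Proof.
move=> /approximableP Ta.
have a0 n : (0 : R) < n.+1%:R^-1 by rewrite invr_gt0 ltr0n.
have h n : exists S : 'L(X, Y) * 'L(dual (dual X), Y),
    [/\ `|T - S.1| <= n.+1%:R^-1, extends_to_bidual S.1 S.2 & finite_rank S.2].
  have [S Sf TS] := Ta _ (a0 n).
  by have [St SSt Stf] := finite_rank_bidual_extension Sf; exists (S, St).
have [S hS] := choice h.
have [n m|Tt TtP] := @complete_seq R 'L(dual (dual X), Y) (fun n => (S n).2).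
  have [TSn SSn _] := hS n; have [TSm SSm _] := hS m.
  rewrite (le_trans (bidual_extension_dist SSn SSm))//.
  rewrite -(subrKA T) (le_trans (ler_normD _ _))// lerD//.
  by rewrite distrC.
have TTt : extends_to_bidual T Tt.
  move=> theta eta; apply/eqP; rewrite -subr_eq0 -normr_le0; apply/ler_addgt0Pr => e e0.
  rewrite add0r.
  pose C := `|eta| * `|theta| + 1; have C0 : 0 < C by rewrite ltr_wpDl// mulr_ge0.
  have [N _ hN] := near_infty_natSinv_lt (PosNum (divr_gt0 (divr_gt0 e0 (ltr0Sn R 1)) C0)).
  have hN' : N.+1%:R^-1 < e / 2 / C := hN N (leqnn N).
  have [TS SS _] := hS N.
  have -> : <[eta, Tt theta]> - <[theta, pullback eta T]> =
      <[eta, (Tt - (S N).2) theta]> - <[theta, pullback eta (T - (S N).1)]>.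
    rewrite [(Tt - _) theta]/(Tt theta - (S N).2 theta) pairingB SS.
    have -> : pullback eta (T - (S N).1) = pullback eta T - pullback eta (S N).1.
      by apply/blop_eqP => x; rewrite /= [LHS]pairingB.
    by rewrite pairingB; ring.
  have h1 : `|<[eta, (Tt - (S N).2) theta]>| <= N.+1%:R^-1 * C.
    rewrite (le_trans (ler_pairing _ _))// mulrC.
    rewrite (le_trans (ler_wpM2r _ (ler_blop _ _)))// -mulrA ler_pM//.
      by rewrite distrC.
    by rewrite mulrC lerDl.
  have h2 : `|<[theta, pullback eta (T - (S N).1)]>| <= N.+1%:R^-1 * C.
    rewrite (le_trans (ler_pairing _ _))//.
    rewrite (le_trans (ler_wpM2l _ (pullback_norm _ _)))// mulrA mulrC ler_pM ?mulr_ge0//.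
    by rewrite mulrC lerDl.
  have hC : N.+1%:R^-1 * C <= e / 2 by rewrite -ler_pdivlMr// ltW.
  rewrite (le_trans (ler_normB _ _))// (splitr e).
  by apply: lerD; [exact: le_trans h1 hC|exact: le_trans h2 hC].
exists Tt; split=> //.
- apply: approximable_limit => e e0.
  have [N _ hN] := near_infty_natSinv_lt (PosNum e0).
  exists (S N).2; first by apply: approximable_finite_rank; have [] := hS N.
  by rewrite distrC (le_trans (TtP N))// ltW//; exact: (hN N (leqnn N)).
- have h0 : extends_to_bidual (0 : 'L(X, Y)) 0.
    move=> theta eta; rewrite [LHS]linear0.
    have -> : pullback eta (0 : 'L(X, Y)) = 0.
      by apply/blop_eqP => x; rewrite [LHS]linear0.
    by rewrite linear0.
  by have := bidual_extension_dist TTt h0; rewrite !subr0.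
Qed.

(** On bounded families [T] turns weak-star convergence into norm convergence: a finite rank
    operator sees only finitely many functionals, and boundedness makes the approximation of [T]
    uniform. *)
Lemma approximable_small X (Y : completeNormedModType R) (T : 'L(X, Y)) Tt
    (I : Type) (U : set_system I) (FU : ProperFilter U) (xi : I -> X) (C : R)
    (theta : dual (dual X)) :
  approximable T -> extends_to_bidual T Tt ->
  U [set i | `|xi i| <= C] ->
  (forall psi : dual X, small (U := U) (fun i => <[psi, xi i]> - <[theta, psi]> : R^o)) ->
  small (U := U) (fun i => T (xi i) - Tt theta).
Proof.
move=> /approximableP Ta TTt xiC xitheta e e0.
(* Replacing [T] by [S] costs [|T - S|] times [C] at [xi i] and times [|theta|] at [theta]; together
   this stays below [e / 2]. *)
pose D := C + `|theta| + 1.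
have D0 : 0 < D.
  have [i] := filter_ex xiC; rewrite /= => iC.
  by rewrite ltr_wpDl// addr_ge0// (le_trans _ iC).
have [S Sf TS] := Ta _ (divr_gt0 (divr_gt0 e0 (ltr0Sn R 1)) D0).
have [St SSt _] := finite_rank_bidual_extension Sf.
have [s sS] := finite_rank_repr Sf.
have Ssmall : small (U := U) (fun i => S (xi i) - St theta).
  have sm := small_sum (U := U) s (fun j => smallZr (U := U) (S j.1) (xitheta (pullback j.2 S))).
  apply: small_ext (sm FU FU) => i /=.
  under eq_bigr do rewrite scalerBl.
  rewrite sumrB [in RHS]sS; congr (_ - _).
  apply/eqP; rewrite -subr_eq0; apply/eqP/eq0_dual => eta.
  rewrite pairingB SSt pairing_sumr.
  have -> : pullback eta S = \sum_(i <- s) <[eta, S i.1]> *: pullback i.2 S.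
    apply/blop_eqP => x; rewrite [RHS]pairing_suml/= {1}sS pairing_sumr.
    by apply: eq_bigr => j _; rewrite pairingZ mulrC.
  rewrite pairing_sumr -sumrB big1// => j _.
  by rewrite !pairingZ mulrC subrr.
have e20 : 0 < e / 2 by rewrite divr_gt0.
apply: filterS (filterI xiC (Ssmall _ e20)) => i [/= ixC iS].
have -> : T (xi i) - Tt theta = (T - S) (xi i) + (S (xi i) - St theta) - (Tt - St) theta.
  rewrite [(T - S) _]/(T _ - S _) [(Tt - St) _]/(Tt _ - St _).
  by rewrite subrKA opprB subrKA.
have h1 : `|(T - S) (xi i)| <= (e / 2 / D) * C.
  by rewrite (le_trans (ler_blop _ _))// ler_pM.
have h2 : `|(Tt - St) theta| <= (e / 2 / D) * `|theta|.
  by rewrite (le_trans (ler_blop _ _))// ler_wpM2r// (le_trans (bidual_extension_dist TTt SSt)).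
have h3 : e / 2 / D * D = e / 2 by rewrite divfK// gt_eqF.
rewrite (le_trans (ler_normB _ _))// (le_trans (lerD (ler_normD _ _) (lexx _)))//.
have : 0 < e / 2 / D by rewrite divr_gt0.
move: h1 h2 h3; rewrite {2}/D; move: (e / 2 / D) => d.
by move=> h1 h2; rewrite !mulrDr mulr1; lra.
Qed.

End BidualExtension.

(** * Derivatives along points and scales *)

Section Derivative.
Context {R : realType}.

Lemma bidual_inclusion_norm_le1 (E : normedModType R) : `|bidual_inclusion E| <= 1.
Proof.
apply: blop_norm_le => // x; rewrite mul1r; apply: blop_norm_le => // phi.
change (`|<[phi, x]>| <= `|x| * `|phi|); by rewrite mulrC ler_pairing.
Qed.

Definition difference_quotient {E G : normedModType R} (g : E -> G) (pt : E * R) (x : E) : G :=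
  pt.2^-1 *: (g (pt.1 + pt.2 *: x) - g pt.1).

Lemma difference_quotient_lip (E G : normedModType R) (g : E -> G) (a : R) pt :
  0 <= a -> (forall x y, `|g x - g y| <= a * `|x - y|) -> forall x y,
  `|difference_quotient g pt x - difference_quotient g pt y| <= a * `|x - y|.
Proof.
move=> a0 ga x y; rewrite -scalerBr normrZ opprB subrKA.
have [->|t0] := eqVneq pt.2 0.
  by rewrite invr0 normr0 mul0r mulr_ge0.
rewrite (le_trans (ler_wpM2l _ (ga _ _)))// opprD addrACA subrr add0r -scalerBr normrZ.
by rewrite mulrCA mulrA [_ * (`|_| * _)]mulrA normfV mulrVK ?unitfE ?normr_eq0//;
   rewrite ?mulrA ?mulVf ?mul1r ?normr_eq0.
Qed.

(* Weak-star limits of the difference quotients of [g] are linear by coarse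
   differentiability, and [T] turns them into norm limits. *)
Lemma approximable_derivative (E G1 : normedModType R) (G : completeNormedModType R)
    (g : E -> G1) (a : R) (T : 'L(G1, G)) :
  0 <= a -> (forall x y, `|g x - g y| <= a * `|x - y|) -> approximable T ->
  exists U : set_system (E * R), UltraFilter U /\ exists D : 'L(E, G),
    [/\ approximable D, `|D| <= `|T| * a, U [set pt | 0 < pt.2] &
      forall x, small (U := U) (fun pt => T (difference_quotient g pt x) - D x)].
Proof.
move=> a0 ga Ta.
pose defect (x y : E) (pt : E * R) := g (pt.1 + pt.2 *: (x + y)) - g (pt.1 + pt.2 *: x)
  - g (pt.1 + pt.2 *: y) + g pt.1.
(* Coarse differentiation applies to scalar functions, so a condition consists of a functional on
   [G1] and a pair of directions; each one also keeps the scale positive. *)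
pose Q (c : dual G1 * (E * E)) (e : R) : set (E * R) :=
  [set pt | 0 < pt.2 /\ `|<[c.1, defect c.2.1 c.2.2 pt]>| <= e * pt.2].
have [c e e' ee' pt [t0 h]|s e e0|U UU UQ] := @ultra_conditions R (E * R) _ Q.
- by split=> //; rewrite (le_trans h)// ler_wpM2r// ltW.
- have [|p [t [t0 h]]] := @coarse_differentiability R E _ s (fun c x => <[c.1, g x]>)
    (fun c => `|c.1| * a) (fun c => c.2.1) (fun c => c.2.2) e e0.
    move=> c x y; rewrite -pairingB (le_trans (ler_pairing _ _))// -mulrA.
    by rewrite ler_wpM2l.
  exists (p, t) => c /h; split=> //.
  by rewrite /defect pairingD !pairingB.
exists U; split=> //.
have Upos : U [set pt | 0 < pt.2] by apply: filterS (UQ (0, (0, 0)) 1 ltr01) => pt [].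
have qlip pt := difference_quotient_lip pt a0 ga.
have q0 pt : difference_quotient g pt 0 = 0.
  by rewrite /difference_quotient scaler0 addr0 subrr scaler0.
(* The limit of the quotients takes values in the bidual of [G1], which is why [T] has to be
   extended there. *)
have [||x y psi e e0|Dt Dta DtP] := @weak_limit R E G1 (dual G1) _ U UU
    (difference_quotient g) a (bidual_inclusion G1) a0.
- by apply: filterE => pt /=; exact: qlip.
- by apply: filterE => pt /=.
- apply: filterS (UQ (psi, (x, y)) e e0) => pt [/= t0 h].
  have -> : difference_quotient g pt (x + y) - difference_quotient g pt x -
     difference_quotient g pt y = pt.2^-1 *: defect x y pt.
    rewrite /difference_quotient -!scalerBr; congr (_ *: _).
    by rewrite /defect !opprB subrKA [g pt.1 - _]addrC addrA.
  change (`|<[psi, pt.2^-1 *: defect x y pt]>| <= e); rewrite pairingZ normrM.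
  by rewrite normfV (gtr0_norm t0) mulrC ler_pdivrMr.
have [Tt [TTt Tta TtT]] := approximable_bidual_extension Ta.
exists (Tt \oL Dt); split=> //.
- exact: approximable_compl.
- rewrite (le_trans (blop_comp_norm _ _))// ler_pM// (le_trans Dta)//.
  by rewrite ler_piMr// bidual_inclusion_norm_le1.
- move=> x; apply: (approximable_small _ Ta TTt (C := a * `|x|)).
    apply: filterE => pt /=.
    by have := qlip pt x 0; rewrite q0 !subr0.
  by move=> psi; exact: DtP.
Qed.

End Derivative.

(** * Averaging the outer Lipschitz map *)

Section Averaging.
Context {R : realType}.

Lemma ler_sum_mem (T : eqType) (s : seq T) (g : T -> R) x :
  (forall y, 0 <= g y) -> x \in s -> g x <= \sum_(y <- s) g y.
Proof.
by move=> g0 xs; rewrite (big_rem x)//= lerDl; apply: sumr_ge0.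
Qed.

(** A finitary substitute for [f = h o W] with [h] Lipschitz: [h] may change with the finite list
    and the tolerance, since the rescaled maps need not have a limit in [F]. *)
Definition lipschitz_approx {E G F : normedModType R} (b : R) (W : 'L(E, G))
    (f : 'L(E, F)) : Prop :=
  forall (X : seq E) (e : R), 0 < e -> exists2 h : G -> F,
    forall y z, `|h y - h z| <= b * `|y - z| &
    forall x, x \in X -> `|h (W x) - f x| <= e.

(* Averaging [h] first over a large box of the range of [W], then over a much
   smaller box of [G], makes it almost additive without changing it much on the
   range of [W], where it is almost linear: a finitary form of the invariant mean
   argument of Lindenstrauss. *)
Lemma almost_additive_average (E G F : normedModType R) (W : 'L(E, G)) (f : 'L(E, F)) (b : R) :
  0 <= b -> lipschitz_approx b W f ->
  forall (s : seq ((G * G) * E)) (e : R), 0 < e -> exists l : G -> F,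
    [/\ forall y z, `|l y - l z| <= b * `|y - z|, l 0 = 0 &
      forall c, c \in s -> `|l (c.1.1 + c.1.2) - l c.1.1 - l c.1.2| <= e /\
        `|l (W c.2) - f c.2| <= e].
Proof.
move=> b0 hP s e e0.
pose Y := [seq c.1.2 | c <- s]; pose X := [seq c.2 | c <- s].
pose CY := \sum_(c <- s) b * `|c.1.1| + 1.
have CY0 : 0 < CY by rewrite ltr_wpDl// sumr_ge0// => c _; rewrite mulr_ge0.
have [Bu Bu0 BuP] := almost_invariant_average Y (divr_gt0 e0 CY0).
(* [Cu] bounds the effect on [h] of shifting by points of [Bu]; so [Bu] is fixed before [Bx] is
   taken large relative to it. *)
pose Cu := \sum_(u <- Bu) b * `|u| + 1.
have Cu0 : 0 < Cu by rewrite ltr_wpDl// sumr_ge0// => c _; rewrite mulr_ge0.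
have e3 : 0 < e / 3 by rewrite divr_gt0.
have [Bx Bx0 BxP] := almost_invariant_average X (divr_gt0 e3 Cu0).
(* [h] comes last: it must be accurate at the points of [Bx] and at their translates by [X]. *)
have [h hb hW] := hP (Bx ++ [seq x + x' | x <- Bx, x' <- X]) _ e3.
(* Subtracting [h (u + W x)] makes [l 0] vanish and leaves summands bounded by [b |y|], although [h]
   itself is unbounded. *)
pose l (y : G) := avg Bu (fun u => avg Bx (fun x => h (y + u + W x) - h (u + W x))).
have lB y z : l y - l z = avg Bu (fun u => avg Bx (fun x => h (y + u + W x) - h (z + u + W x))).
  rewrite /l -avgB; congr avg; apply/funext => u; rewrite -avgB; congr avg.
  by apply/funext => x; rewrite opprB subrKA.
exists l; split.
- move=> y z; rewrite lB; apply: avg_norm_le => [|u _]; first exact: mulr_ge0.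
  apply: avg_norm_le => [|x _]; first exact: mulr_ge0.
  rewrite (le_trans (hb _ _))// -[y + u + _]addrA -[z + u + _]addrA.
  by rewrite opprD addrACA subrr addr0.
- rewrite /l -[RHS](avg_cst _ Bu0); congr avg; apply/funext => u.
  rewrite -[RHS](avg_cst _ Bx0); congr avg; apply/funext => x.
  by rewrite add0r subrr.
move=> c cs; split.
  pose phi u := avg Bx (fun x => h (c.1.1 + u + W x) - h (u + W x)).
  have phiC u : `|phi u| <= b * `|c.1.1|.
    apply: avg_norm_le => [|x _]; first exact: mulr_ge0.
    by rewrite (le_trans (hb _ _))// -[_ + u + _]addrA addrK.
  have -> : l (c.1.1 + c.1.2) - l c.1.1 - l c.1.2 = avg Bu (fun u => phi (u + c.1.2)) - avg Bu phi.
    rewrite addrAC lB; congr (_ - _); congr avg; apply/funext => u.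
    congr avg; apply/funext => x.
    by rewrite addrA [c.1.2 + u]addrC -!addrA [c.1.2 + (u + _)]addrCA.
  rewrite (le_trans (BuP _ _ _ phiC _ (map_f _ cs)))//.
  rewrite mulrAC ler_pdivrMr// ler_wpM2l ?(ltW e0)//.
  rewrite (le_trans (ler_sum_mem (g := fun c => b * `|c.1.1|) _ cs))//.
    by move=> d; exact: mulr_ge0.
  by rewrite lerDl.
have x'X : c.2 \in X by apply: map_f.
set x' := c.2.
have -> : l (W x') - f x' = avg Bu (fun u => avg Bx (fun x => h (W x' + u + W x) - h (u + W x)) - f x').
  by rewrite avgB avg_cst.
apply: avg_norm_le => [|u uBu]; first exact: ltW.
pose psi x := h (u + W x) - h (W x).
have psiC x : `|psi x| <= b * `|u| by rewrite (le_trans (hb _ _))// addrK.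
(* The shift by [W x'] becomes a translation of [Bx] by [x']. Its invariance error and two
   approximation errors of [h o W] contribute [e / 3] each. *)
have -> : avg Bx (fun x => h (W x' + u + W x) - h (u + W x)) - f x' =
    (avg Bx (fun x => psi (x + x')) - avg Bx psi) +
    avg Bx (fun x => (h (W (x + x')) - f (x + x')) - (h (W x) - f x)).
  rewrite -[f x'](avg_cst _ Bx0) -!avgB -avgD; congr avg; apply/funext => x.
  have -> : W x' + u + W x = u + W (x + x').
    by rewrite linearD [W x' + u]addrC -addrA [W x' + _]addrC.
  have fD : f (x + x') = f x + f x' by rewrite linearD.
  rewrite /psi fD; move: (f x) (f x') (h (W x)) (h (u + W x)).
  move: (h (u + W (x + x'))) (h (W (x + x'))) => p r m n v q.
  have -> : p - r - (q - v) = p - q - (r - v).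
    by rewrite opprB [v - q]addrC addrACA [- r + v]addrC [in RHS]opprB.
  have -> : r - (m + n) - (v - m) = r - v - n.
    by rewrite opprB [m - v]addrC addrACA [m + n]addrC opprD subrK.
  by rewrite subrKA.
rewrite (le_trans (ler_normD _ _))//.
have h1 : `|avg Bx (fun x => psi (x + x')) - avg Bx psi| <= e / 3.
  rewrite (le_trans (BxP _ _ _ psiC _ x'X))// mulrAC ler_pdivrMr// ler_wpM2l ?(ltW e3)//.
  rewrite (le_trans (ler_sum_mem (g := fun u => b * `|u|) _ uBu))//.
    by move=> d; exact: mulr_ge0.
  by rewrite lerDl.
have h2 : `|avg Bx (fun x => (h (W (x + x')) - f (x + x')) - (h (W x) - f x))| <= e / 3 + e / 3.
  apply: avg_norm_le => [|x xB]; first by rewrite addr_ge0 ?(ltW e3).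
  rewrite (le_trans (ler_normB _ _))// lerD// hW// mem_cat ?xB// orbC.
  by rewrite allpairs_f.
by lra.
Qed.

End Averaging.

(** * The least Lipschitz constant *)

Section LipschitzConstant.
Context {R : realType}.
Implicit Types E F : completeNormedModType R.

Lemma inf_nonneg (A : set R) : (forall x, A x -> 0 <= x) -> 0 <= inf A.
Proof.
move=> A0; have [->|/set0P Ane] := eqVneq A set0; first by rewrite inf0.
exact: lb_le_inf.
Qed.

Lemma Lip_ge0 E F (f : E -> F) : 0 <= Lip f.
Proof. by apply: inf_nonneg => k []. Qed.

Lemma LipP E F (f : E -> F) : lipschitz f ->
  forall x y, `|f x - f y| <= Lip f * `|x - y|.
Proof.
move=> /pinfty_ex_gt0[M M0 fM] x y.
have [->|xy] := eqVneq x y; first by rewrite !subrr !normr0 mulr0.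
have xy0 : 0 < `|x - y| by rewrite normr_gt0 subr_eq0.
rewrite -ler_pdivrMr//; apply: lb_le_inf.
  by exists M; split; [exact: ltW|exact: fM].
by move=> k [_ fk]; rewrite ler_pdivrMr//; exact: (fk (x, y)).
Qed.

Lemma Lip_le E F (f : E -> F) (k : R) : 0 <= k ->
  (forall x y, `|f x - f y| <= k * `|x - y|) -> Lip f <= k.
Proof.
move=> k0 fk; apply: ge_inf; first by exists 0 => j [].
by split=> // -[x y] _; exact: fk.
Qed.

End LipschitzConstant.

(** * Linearization of the inner and the outer map *)

Section LinearizedFactorization.
Context {R : realType}.
Implicit Types E F G H : normedModType R.

Lemma filter_all (I : Type) (T : eqType) (U : set_system I) (FU : Filter U)
    (s : seq T) (P : T -> set I) :
  (forall x, U (P x)) -> U [set i | forall x, x \in s -> P x i].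
Proof.
move=> UP; elim: s => [|x s IH]; first exact: filterE.
apply: filterS (filterI (UP x) IH) => i [Px h] y.
by rewrite inE => /predU1P[->//|]; exact: h.
Qed.

(** Linearity of [f] enters here: quotients of [g1] at [(p, t)] and of [g2] at the image of [p] with
    the same [t] compose exactly to [f]. The Lipschitz bound on the latter then allows the former to
    be replaced by [D]. *)
Lemma linearized_factorization E (G1 : normedModType R) (G : completeNormedModType R)
    H F (g1 : E -> G1) (a : R) (T : 'L(G1, G)) (S : 'L(G, H)) (g2 : H -> F) (b : R)
    (f : 'L(E, F)) :
  0 <= a -> (forall x y, `|g1 x - g1 y| <= a * `|x - y|) ->
  0 <= b -> (forall x y, `|g2 x - g2 y| <= b * `|x - y|) ->
  approximable T -> (forall x, f x = g2 (S (T (g1 x)))) ->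
  exists D : 'L(E, G), [/\ approximable D, `|D| <= `|T| * a &
    lipschitz_approx b (S \oL D) f].
Proof.
move=> a0 g1a b0 g2b Ta fE.
have [U [UU [D [Da DT Upos UD]]]] := approximable_derivative a0 g1a Ta.
exists D; split=> // X e e0.
pose C := b * `|S| + 1; have C0 : 0 < C by rewrite ltr_wpDl// mulr_ge0.
have [[p t] [/= t0 hX]] :=
  filter_ex (filterI Upos (filter_all _ X (fun x => UD x _ (divr_gt0 e0 C0)))).
pose y0 := S (T (g1 p)).
exists (difference_quotient g2 (y0, t)).
  exact: difference_quotient_lip.
move=> x xX; set q := difference_quotient g1 (p, t) x.
have -> : f x = difference_quotient g2 (y0, t) (S (T q)).
  have tq : t *: S (T q) = S (T (g1 (p + t *: x))) - y0.
    rewrite /q /difference_quotient/= !linearZ/= scalerA mulVf ?gt_eqF// scale1r.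
    by rewrite !linearB.
  rewrite /difference_quotient/= tq [y0 + _]addrC subrK /y0 -!fE.
  have -> : f (p + t *: x) = f p + t *: f x by rewrite linearD linearZ.
  by rewrite addrAC subrr add0r scalerA mulVf ?gt_eqF// scale1r.
rewrite (le_trans (difference_quotient_lip _ b0 g2b _ _))// -linearB.
rewrite (le_trans (ler_wpM2l b0 (ler_blop S _)))// mulrA distrC.
rewrite (le_trans (ler_wpM2l _ (hX x xX))) ?mulr_ge0//.
by rewrite mulrCA ger_pMr// ler_pdivrMr// mul1r lerDl.
Qed.

(** The maps themselves index the ultrafilter, so later arguments can take limits in [l], or choose
    one [l] good for finitely many conditions. *)
Lemma asymptotically_linear_maps E G F (W : 'L(E, G)) (f : 'L(E, F)) (b : R) :
  0 <= b -> lipschitz_approx b W f ->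
  exists U : set_system (G -> F), UltraFilter U /\
    [/\ U [set l | forall y z, `|l y - l z| <= b * `|y - z|],
        U [set l | l 0 = 0],
        forall y z, small (U := U) (fun l => l (y + z) - l y - l z) &
        forall x, small (U := U) (fun l => l (W x) - f x)].
Proof.
move=> b0 hP.
pose Q (c : (G * G) * E) (e : R) : set (G -> F) := [set l |
  [/\ forall y z, `|l y - l z| <= b * `|y - z|, l 0 = 0,
     `|l (c.1.1 + c.1.2) - l c.1.1 - l c.1.2| <= e & `|l (W c.2) - f c.2| <= e]].
have [c e e' ee' l [? ? h1 h2]|s e e0|U UU UQ] := @ultra_conditions R (G -> F) _ Q.
- by split=> //; [exact: le_trans h1 ee'|exact: le_trans h2 ee'].
- have [l [lb l0 lP]] := almost_additive_average b0 hP s e0.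
  by exists l => c /lP[].
exists U; split=> //; split.
- by apply: filterS (UQ 0 1 ltr01) => l [].
- by apply: filterS (UQ 0 1 ltr01) => l [].
- by move=> y z e e0; apply: filterS (UQ ((y, z), 0) e e0) => l [].
- by move=> x e e0; apply: filterS (UQ ((0, 0), x) e e0) => l [].
Qed.

Lemma dual_valued_extension E G F K (W : 'L(E, G)) (f : 'L(E, F)) (b : R)
    (iota : 'L(F, dual K)) :
  0 <= b -> lipschitz_approx b W f ->
  exists2 L : 'L(G, dual K), `|L| <= b * `|iota| & L \oL W = iota \oL f.
Proof.
move=> b0 hP.
have [U [UU [lb l0 lD lW]]] := asymptotically_linear_maps b0 hP.
have iota_small (l : (G -> F) -> F) (g : K) : small (U := U) l ->
    small (U := U) (fun i => <[iota (l i), g]> : R^o).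
  move=> sl; apply: (small_dominated (K := `|iota| * `|g|) sl).
  apply: filterE => i /=; rewrite (le_trans (ler_pairing _ _))// mulrAC ler_wpM2r//.
  exact: ler_blop.
have [|L Lb LP] := @weak_limit R G F K _ U UU (fun l => l) b iota b0 lb l0.
  by move=> y z g; apply: (iota_small (fun l => l (y + z) - l y - l z)).
exists L => //; apply: blop_eqP => x; apply: blop_eqP => g.
apply/eqP; rewrite -subr_eq0; apply/eqP; apply: (@small_uniq _ _ U _ R^o).
apply: small_ext (smallB (iota_small _ g (lW x)) (LP (W x) g)) => l /=.
by rewrite linearB pairingBl /=; ring.
Qed.

End LinearizedFactorization.

(** * Helly's lemma *)

Section Helly.
Context {R : realType}.
Implicit Types X Y : normedModType R.

Lemma pullback_repr X Y (T : 'L(X, Y)) (s : seq (X * dual Y)) (eta : dual Y) :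
  (forall z, T z = \sum_(i <- s) (<[i.2, T z]> : R) *: T i.1) ->
  pullback eta T = \sum_(i <- s) <[eta, T i.1]> *: pullback i.2 T.
Proof.
move=> sT; apply/blop_eqP => x; rewrite [RHS]pairing_suml/= {1}sT pairing_sumr.
by apply: eq_bigr => i _; rewrite pairingZ mulrC.
Qed.

(** [e0] solves the equations without control of its norm. By Hahn-Banach its distance to the kernel
    of [T] is the value at [e0] of a functional of norm at most 1 vanishing on that kernel; this is
    a pullback along [T], so [theta] takes the same value on it. *)
Lemma helly X Y (T : 'L(X, Y)) (theta : dual (dual X)) : finite_rank T ->
  exists2 x : X, `|x| <= `|theta| + 1 &
    forall eta : dual Y, <[eta, T x]> = <[theta, pullback eta T]>.
Proof.
move=> /finite_rank_repr[s sT].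
pose e0 := \sum_(i <- s) (<[theta, pullback i.2 T]> : R) *: i.1.
have e0E (eta : dual Y) : <[eta, T e0]> = <[theta, pullback eta T]>.
  rewrite (pullback_repr eta sT) pairing_sumr /e0 linear_sum pairing_sumr.
  by apply: eq_bigr => i _; rewrite linearZ !pairingZ mulrC.
(* [p] is the quotient norm modulo the kernel of [T]. *)
pose D x := [set `|x - n| | n in [set n | T n = 0]].
pose p x := inf (D x).
have p_le x n : T n = 0 -> p x <= `|x - n|.
  by move=> Tn; apply: ge_inf; [exists 0 => _ [m _ <-]|exists n].
have p_ge x c : (forall n, T n = 0 -> c <= `|x - n|) -> c <= p x.
  move=> h; apply: lb_le_inf; last by move=> _ [n /h ? <-].
  by exists `|x - 0|; exists 0 => //=; rewrite linear0.
have p0 : p 0 = 0.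
  apply/eqP; rewrite eq_le p_ge// andbT.
  by have := p_le 0 0 (linear0 _); rewrite subrr normr0.
have sp : sublinear p.
  apply: sublinear_of_le => // [x y|t x t0].
    rewrite -lerBlDr; apply: (@p_ge) => n Tn; rewrite lerBlDr -lerBlDl.
    apply: (@p_ge) => m Tm; rewrite lerBlDl (le_trans (p_le _ (n + m) _))//.
      by rewrite linearD/= Tn Tm addr0.
    by rewrite opprD addrACA ler_normD.
  rewrite mulrC -ler_pdivrMr//; apply: (@p_ge) => n Tn.
  rewrite ler_pdivrMr// mulrC -{2}(gtr0_norm t0) -normrZ scalerBr.
  by apply: p_le; rewrite linearZ/= Tn scaler0.
have px x : p x <= 1 * `|x|.
  by rewrite mul1r; have := p_le x 0 (linear0 _); rewrite subr0.
have [phi [phi1 phip phie0]] := hahn_banach_normed e0 sp ler01 px.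
have phiT n : T n = 0 -> <[phi, n]> = 0 :> R.
  move=> Tn; apply/eqP; rewrite eq_le (le_trans (phip n)); last first.
    by have := p_le n n Tn; rewrite subrr normr0.
  rewrite -oppr_le0; have <- : <[phi, - n]> = - <[phi, n]> :> R by rewrite linearN.
  rewrite (le_trans (phip _))//; have := p_le (- n) (- n).
  by rewrite linearN/= Tn oppr0 subrr normr0 => /(_ erefl).
have phiE : phi = \sum_(i <- s) <[phi, i.1]> *: pullback i.2 T.
  apply/blop_eqP => z.
  have Tz0 : T (z - \sum_(i <- s) (<[i.2, T z]> : R) *: i.1) = 0.
    rewrite linearB/= {1}sT linear_sum/= -sumrB big1// => i _.
    by rewrite linearZ subrr.
  have := phiT _ Tz0; rewrite pairingB => /eqP; rewrite subr_eq0 => /eqP ->.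
  rewrite pairing_suml pairing_sumr.
  by apply: eq_bigr => i _; rewrite pairingZ pairingZl mulrC.
have pe0 : p e0 <= `|theta|.
  rewrite -phie0 {1}[e0]lock phiE -lock pairing_suml.
  have -> : \sum_(i <- s) <[<[phi, i.1]> *: pullback i.2 T : dual X, e0]> =
      <[theta, phi]>.
    rewrite {2}phiE pairing_sumr; apply: eq_bigr => i _.
    by rewrite pairingZl pairingZ -(e0E i.2).
  rewrite (le_trans (ler_norm _))// (le_trans (ler_pairing _ _))//.
  by rewrite ler_piMr.
(* The distance need not be attained; the [+ 1] leaves room for a near minimizer. *)
have [_ [n Tn <-] np] : exists2 d, D e0 d & d < `|theta| + 1.
  apply: inf_lt; last by rewrite (le_lt_trans pe0)// ltrDl.
  by exists `|e0 - 0|; exists 0 => //=; rewrite linear0.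
exists (e0 - n); first exact: ltW.
by move=> eta; rewrite linearB/= Tn subr0 e0E.
Qed.

Lemma approximable_helly X Y (T : 'L(X, Y)) (theta : dual (dual X)) (d : R) :
  approximable T -> 0 < d ->
  exists x : X, forall eta : dual Y, `|eta| <= 1 ->
    `|<[eta, T x]> - <[theta, pullback eta T]>| <= d.
Proof.
move=> /approximableP Ta d0.
(* The error [|T - S|] is multiplied by [|x| <= |theta| + 1] in one pairing and by [|theta|] in the
   other. *)
pose C := 2 * `|theta| + 1; have C0 : 0 < C by rewrite ltr_wpDl// mulr_ge0.
have [S Sf TS] := Ta _ (divr_gt0 d0 C0).
have [x xt xS] := helly theta Sf; exists x => eta eta1.
have -> : <[eta, T x]> - <[theta, pullback eta T]> =
    <[eta, (T - S) x]> - <[theta, pullback eta (T - S)]>.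
  have -> : pullback eta (T - S) = pullback eta T - pullback eta S.
    by apply/blop_eqP => z; rewrite /= [LHS]pairingB.
  by rewrite [(T - S) x]/(T x - S x) !pairingB xS; ring.
have dC : d / C * (2 * `|theta| + 1) = d by rewrite divfK// gt_eqF.
have h1 : `|<[eta, (T - S) x]>| <= d / C * (`|theta| + 1).
  rewrite (le_trans (ler_pairing _ _))// -[leRHS]mul1r ler_pM//.
  by rewrite (le_trans (ler_blop _ _))// ler_pM.
have h2 : `|<[theta, pullback eta (T - S)]>| <= d / C * `|theta|.
  rewrite (le_trans (ler_pairing _ _))// mulrC ler_wpM2r//.
  by rewrite (le_trans (pullback_norm _ _))// -[leRHS]mul1r ler_pM.
rewrite (le_trans (ler_normB _ _))//.
by move: h1 h2 dC; move: (d / C) => t; lra.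
Qed.

End Helly.

(** * Consequences of the approximation property of the dual *)

Section ApproximationProperty.
Context {R : realType}.

(** Total boundedness in terms of ultrafilters: one that contains balls of every radius is
    Cauchy. *)
Lemma ultra_compact (X : completeNormedModType R) (K : set X) : closed K ->
  (forall U : set_system X, UltraFilter U -> U K ->
    forall e : R, 0 < e -> exists y, U [set x | `|x - y| <= e]) ->
  compact K.
Proof.
move=> Kc hK; rewrite compact_ultra => U UU UK.
have Ucvg : cvg (U : set_system X).
  apply: cauchy_cvg; apply/cauchy_ballP => e e0.
  have e40 : 0 < e / 4 by rewrite divr_gt0.
  have [y Uy] := hK U UU UK _ e40.
  exists ([set x | `|x - y| <= e / 4], [set x | `|x - y| <= e / 4]) => //.
  move=> [u v]/= [uy vy]; rewrite -ball_normE/= -(subrKA y).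
  by rewrite (le_lt_trans (ler_normD _ _))// [`|y - v|]distrC; lra.
exists (lim (U : set_system X)); split; last exact: Ucvg.
by apply: Kc => B /Ucvg UB; exact: filter_ex (filterI UK UB).
Qed.

(** Schauder's theorem for approximable operators: up to a small error, a pullback depends only on
    the finitely many bounded numbers [<[eta, S i.1]>], which converge along any ultrafilter. *)
Lemma approximable_pullback_compact (E G : completeNormedModType R) (D : 'L(E, G)) :
  approximable D ->
  compact (closure [set pullback eta D | eta in [set eta : dual G | `|eta| <= 1]] : set (dual E)).
Proof.
move=> /approximableP Da; set A := [set _ | _ in _].
apply: ultra_compact; first exact: closed_closure.
move=> U UU UK e e0; have e30 : 0 < e / 3 by rewrite divr_gt0.
have [S Sf DS] := Da _ e30.
have [s sS] := finite_rank_repr Sf.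
(* The default [0] off the closure keeps [|eta k| <= 1] for every [k]. *)
have hA (k : dual E) : exists eta : dual G, `|eta| <= 1 /\
    (closure A k -> `|k - pullback eta D| <= e / 3).
  have [kA|kA] := pselect (closure A k); last by exists 0; rewrite normr0.
  have [_ [[eta eta1 <-]]] := kA _ (nbhsx_ballx k _ e30).
  by rewrite -ball_normE/= => /ltW ?; exists eta.
have [eta etaP] := choice hA.
have hc (i : E * dual G) : exists c : R, small (U := U) (fun k => <[eta k, S i.1]> - c : R^o).
  have [|c /cvg_small] := @ultra_cvgR R _ U (fun k => <[eta k, S i.1]>) `|S i.1| UU; last by exists c.
  apply: filterE => k /=; rewrite (le_trans (ler_pairing _ _))// ler_piMl//.
  by have [] := etaP k.
have [c cP] := choice hc.
exists (\sum_(i <- s) c i *: pullback i.2 S).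
have sm := small_sum (U := U) s (fun i => smallZr (U := U) (pullback i.2 S) (cP i)).
apply: filterS (filterI UK (sm _ _ _ e30)) => k [/= kA ks].
have [eta1 /(_ kA) h1] := etaP k.
have h2 : `|pullback (eta k) D - pullback (eta k) S| <= e / 3.
  rewrite (_ : pullback _ D - _ = pullback (eta k) (D - S)).
    by rewrite (le_trans (pullback_norm _ _))// -[leRHS]mul1r ler_pM.
  by apply/blop_eqP => z; rewrite /= [RHS]pairingB.
have h3 : `|pullback (eta k) S - \sum_(i <- s) c i *: pullback i.2 S| <= e / 3.
  rewrite (pullback_repr _ sS) -sumrB.
  by under eq_bigr do rewrite -scalerBl.
rewrite -(subrKA (pullback (eta k) D)) (le_trans (ler_normD _ _))//.
rewrite -[pullback (eta k) D - _](subrKA (pullback (eta k) S)).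
rewrite (le_trans (lerD h1 (ler_normD _ _)))//; lra.
Qed.

(** The finite rank [Q] on [dual E] need not be an adjoint: its coefficients are the bidual elements
    [pullback i.2 Q]. Helly's lemma replaces these by vectors of [E], accurately enough on the
    functionals factoring through [D], and yields [P]. *)
Lemma approximation_property_dual (E G : completeNormedModType R) (D : 'L(E, G)) (e : R) :
  approximation_property (dual E) -> approximable D -> 0 < e ->
  exists2 P : 'L(E, E), finite_rank P & `|D - (D \oL P)| <= e.
Proof.
move=> AP Da e0; have e20 : 0 < e / 2 by rewrite divr_gt0.
have [Q /finite_rank_repr[t tQ] QP] := AP _ _ (approximable_pullback_compact Da) e20.
(* [M] makes the Helly errors, weighted by [|Q i.1|], add up to at most [e / 2]. *)
pose M := \sum_(i <- t) `|Q i.1| + 1.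
have M0 : 0 < M by rewrite ltr_wpDl// sumr_ge0.
have [x xP] := choice (fun theta => approximable_helly theta Da (divr_gt0 e20 M0)).
pose P : 'L(E, E) := \sum_(i <- t) rank1 (Q i.1) (x (pullback i.2 Q)).
exists P; first by apply: finite_rank_bigsum => i; exact: finite_rank_rank1.
apply: blop_norm_le_dual => [|z eta eta1]; first exact: ltW.
set k := pullback eta D.
have kA : closure [set pullback eta D | eta in [set eta : dual G | `|eta| <= 1]] k.
  by apply: subset_closure; exists eta.
have -> : <[eta, (D - (D \oL P)) z]> = - <[Q k - k, z]> +
    \sum_(i <- t) <[Q i.1, z]> * (<[pullback i.2 Q, k]> - <[eta, D (x (pullback i.2 Q))]>).
  rewrite [(D - _) z]/(D z - D (P z)) pairingB pairingBl tQ pairing_suml.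
  rewrite blop_sumE linear_sum pairing_sumr.
  under [X in _ = _ + X]eq_bigr do rewrite mulrBr.
  rewrite sumrB opprB -addrA; congr (_ + _).
  rewrite addrA; under [X in - X + _]eq_bigr do rewrite pairingZl mulrC.
  rewrite addNr add0r; congr (- _); apply: eq_bigr => i _.
  by rewrite linearZ pairingZ.
rewrite (le_trans (ler_norm _))// (le_trans (ler_normD _ _))//.
rewrite (splitr e) mulrDl lerD//.
  by rewrite normrN (le_trans (ler_pairing _ _))// ler_wpM2r// QP.
rewrite (le_trans (ler_norm_sum _ _ _))//.
rewrite (@le_trans _ _ (\sum_(i <- t) `|Q i.1| * (`|z| * (e / 2 / M))))//.
  apply: ler_sum => i _; rewrite normrM mulrA ler_pM// ?ler_pairing//.
  by rewrite distrC; exact: xP.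
rewrite -mulr_suml mulrCA mulrC ler_wpM2r//.
rewrite mulrA ler_pdivrMr// mulrC ler_wpM2l ?(ltW e20)//.
by rewrite lerDl.
Qed.

End ApproximationProperty.

(** * Finite rank outer factors *)

Section FiniteRankFactorization.
Context {R : realType}.

Lemma asymptotic_sum {I : Type} {U : set_system I} {FU : ProperFilter U}
    {E F : normedModType R} (q : I -> E -> F) (K : R) :
  0 <= K ->
  U [set i | forall x y, `|q i x - q i y| <= K * `|x - y|] ->
  U [set i | q i 0 = 0] ->
  (forall x y, small (U := U) (fun i => q i (x + y) - q i x - q i y)) ->
  forall (J : Type) (s : seq J) (c : J -> R) (y : J -> E),
  small (U := U) (fun i => q i (\sum_(j <- s) c j *: y j) - \sum_(j <- s) c j *: q i (y j)).
Proof.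
move=> K0 qK q0 qD J s c y; elim: s => [|j s IH].
  move=> e e0; apply: filterS q0 => i /= qi0.
  by rewrite !big_nil qi0 subrr normr0 ltW.
apply: (small_trans (g := fun i => q i (c j *: y j) + q i (\sum_(j <- s) c j *: y j))).
  apply: small_ext (qD (c j *: y j) (\sum_(j <- s) c j *: y j)) => i.
  by rewrite big_cons opprD addrA.
apply: small_ext (smallD (asymptotic_homogeneity K0 qK q0 qD (c j) (y j)) IH) => i.
by rewrite big_cons opprD addrACA.
Qed.

Lemma lipschitz_approx_norm_le {E G F : normedModType R} (W : 'L(E, G)) (f : 'L(E, F))
  (b : R) x : lipschitz_approx b W f -> `|f x| <= b * `|W x|.
Proof.
move=> hP; apply/ler_addgt0Pr => e e0; have e20 : 0 < e / 2 by rewrite divr_gt0.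
(* [h 0] need not vanish, so [0] is put on the list as well. *)
have [h hb hX] := hP [:: x; 0] _ e20.
have h1 : `|h (W x) - f x| <= e / 2 by apply: hX; rewrite inE eqxx.
have h2 : `|h 0| <= e / 2.
  have z1 : 0 \in [:: x; 0] by rewrite !inE eqxx orbT.
  have f0 : f 0 = 0 by exact: linear0.
  have W0 : W 0 = 0 by exact: linear0.
  by have := hX 0 z1; rewrite W0 f0 subr0.
have := hb (W x) 0; rewrite subr0 => h3.
rewrite -(subKr (h (W x)) (f x)) (le_trans (ler_normB _ _))//.
have h4 : `|h (W x)| <= `|h (W x) - h 0| + `|h 0|.
  by rewrite -{1}(subrK (h 0) (h _)) ler_normD.
lra.
Qed.

(* Along the ultrafilter of asymptotically linear maps [l], the linear maps
   [V1 l], which agree with [l] on the finitely many vectors spanning the range of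
   a finite rank approximation of [V0], are almost [b]-Lipschitz and almost
   solve the equation; a small finite rank perturbation [V2] solves it exactly. *)
Lemma finite_rank_factorization {E H G F : normedModType R} (T : 'L(E, H))
    (V0 : 'L(H, G)) (f : 'L(E, F)) (b : R) (P : 'L(E, E)) (e : R) :
  0 <= b -> lipschitz_approx b (V0 \oL T) f ->
  approximable V0 -> finite_rank P -> 0 < e ->
  exists V : 'L(H, F), [/\ finite_rank V, `|V| <= b * `|V0| + e &
    (V \oL T) \oL P = f \oL P].
Proof.
move=> b0 hP /approximableP V0a Pf e0.
have [U [UU [lb l0 lD lW]]] := asymptotically_linear_maps b0 hP.
have [s sP] := finite_rank_repr (finite_rank_compr T Pf).
pose A := \sum_(i <- s) `|i.2| * `|T (P i.1)|.
have A0 : 0 <= A by apply: sumr_ge0 => i _; exact: mulr_ge0.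
pose M := \sum_(i <- s) `|i.2| + 1.
have M0 : 0 < M by rewrite ltr_wpDl// sumr_ge0.
have e3 : 0 < e / 3 by rewrite divr_gt0.
(* The error in [V0] enters once through [b |R0|] and, weighted by [A], through the correction [V2];
   [C] keeps the sum below [e / 3]. *)
pose C := b * (1 + A) + 1.
have C0 : 0 < C by rewrite ltr_wpDl// mulr_ge0// addr_ge0.
have [R0 R0f VR] := V0a _ (divr_gt0 e3 C0).
have [r rR] := finite_rank_repr R0f.
pose y (j : H * dual G) : G := R0 j.1.
have [rho R0E] : exists rho : H * dual G -> dual H,
    forall u, R0 u = \sum_(j <- r) (<[rho j, u]> : R) *: y j.
  by exists (fun j => pullback j.2 R0); exact: rR.
pose V1 (l : G -> F) : 'L(H, F) := \sum_(j <- r) rank1 (rho j) (l (y j)).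
have V1E l u : V1 l u = \sum_(j <- r) (<[rho j, u]> : R) *: l (y j).
  by rewrite /V1 blop_sumE.
(* The point may vary with [l]: its finitely many coordinates converge along [U], so [R0 (u l)] can
   be replaced by the fixed vector [y1]. *)
have selection (u : (G -> F) -> H) (B : R) : (forall l, `|u l| <= B) ->
    small (U := U) (fun l => l (R0 (u l)) - V1 l (u l)).
  move=> uB.
  have hc (j : H * dual G) : exists c : R, small (U := U) (fun l => <[rho j, u l]> - c : R^o).
    have [|c /cvg_small] := @ultra_cvgR R _ U (fun l => <[rho j, u l]>) (`|rho j| * B) UU; last by exists c.
    by apply: filterE => l /=; rewrite (le_trans (ler_pairing (rho j) _))// ler_wpM2l.
  have [c cP] := choice hc.
  pose y1 := \sum_(j <- r) c j *: y j.
  have s1 : small (U := U) (fun l => l (R0 (u l)) - l y1).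
    apply: (@small_dominated R _ U _ F G b _ (fun l => R0 (u l) - y1)).
      apply: small_ext (small_sum r (fun j => smallZr (y j) (cP j))) => l /=.
      by rewrite R0E -sumrB; apply: eq_bigr => j _; rewrite scalerBl.
    by apply: filterS lb => l /= h; exact: h.
  apply: (small_trans s1); apply: (small_trans (asymptotic_sum b0 lb l0 lD r c y)).
  have s2 : small (U := U) (fun l => \sum_(j <- r) (c j - <[rho j, u l]>) *: l (y j)).
    apply: small_sum => j; apply: (small_dominated (K := b * `|y j|) (cP j)).
    apply: filterS (filterI lb l0) => l [/= h h0].
    rewrite normrZ mulrC distrC ler_wpM2r//.
    by have := h (y j) 0; rewrite h0 !subr0.
  apply: small_ext s2 => l; rewrite V1E -sumrB.
  by apply: eq_bigr => j _; rewrite scalerBl.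
have V1norm : U [set l | `|V1 l| <= b * `|R0| + e / 3].
  (* Selecting a bad point for each [l], whenever there is one, turns [selection] into an estimate
     uniform on the unit ball. *)
  pose bad l := [set u : H | `|u| <= 1 /\ e / 3 < `|l (R0 u) - V1 l u|].
  have hu l : exists u, `|u| <= 1 /\ (bad l u \/ bad l = set0).
    have [[u [u1 lu]]|/set0P/negP/negPn/eqP bl0] := pselect (bad l !=set0).
      by exists u; split=> //; left.
    by exists 0; rewrite normr0; split=> //; right.
  have [u uP] := choice hu.
  have := selection u 1 (fun l => (uP l).1) _ e3.
  move=> h; apply: filterS (filterI h (filterI lb l0)) => l [/= hl [lbl ll0]].
  have V1u v : `|v| <= 1 -> `|V1 l v| <= b * `|R0| + e / 3.
    move=> v1.
    have lv : `|l (R0 v) - V1 l v| <= e / 3.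
      have [_ [[_]|bl0]] := uP l; first by rewrite ltNge hl.
      rewrite leNgt; apply/negP => lv.
      have : bad l v by [].
      by rewrite bl0.
    rewrite -(subKr (l (R0 v)) (V1 l v)) (le_trans (ler_normB _ _))// lerD//.
    have := lbl (R0 v) 0; rewrite ll0 !subr0 => /le_trans; apply.
    by rewrite ler_wpM2l// (le_trans (ler_blop _ _))// ler_piMr.
  have c0 : 0 <= b * `|R0| + e / 3 by rewrite addr_ge0 ?mulr_ge0// ltW.
  apply: blop_norm_le => // v.
  have [->|v0] := eqVneq v 0; first by rewrite linear0 !normr0 mulr0.
  have nv0 : 0 < `|v| by rewrite normr_gt0.
  rewrite -ler_pdivrMr//.
  have := V1u (`|v|^-1 *: v); rewrite linearZ/= !normrZ normfV normr_id mulVf ?gt_eqF//.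
  by move=> /(_ (lexx _)); rewrite mulrC.
pose w (i : E * dual H) := T (P i.1).
pose err (i : E * dual H) l := (V1 l (w i) - l (R0 (w i))) + (l (V0 (w i)) - f (P i.1)).
have err_small i : small (U := U) (err i).
  apply: smallD; last exact: (lW (P i.1)).
  apply: small_ext (smallN (selection (fun _ => w i) _ (fun _ => lexx _))) => l /=.
  by rewrite opprB.
have [l [/= [lbl V1l] errl]] := filter_ex (filterI (filterI lb V1norm)
  (filter_all _ s (fun i => err_small i _ (divr_gt0 e3 M0)))).
(* By the representation [s], correcting [V1 l] at the vectors [w i] corrects it on the whole range
   of [T o P]. *)
pose V2 : 'L(H, F) := \sum_(i <- s) rank1 i.2 (f (P i.1) - V1 l (w i)).
exists (V1 l + V2); split.
- apply: finite_rankD; apply: finite_rank_bigsum => i; exact: finite_rank_rank1.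
- have RV : `|R0| <= `|V0| + e / 3 / C.
    by rewrite -(subKr V0 R0) (le_trans (ler_normB _ _))// lerD2l.
  have V2i i : i \in s -> `|f (P i.1) - V1 l (w i)| <= e / 3 / M + b * (e / 3 / C) * `|w i|.
    move=> si; rewrite distrC.
    have -> : V1 l (w i) - f (P i.1) = err i l + (l (R0 (w i)) - l (V0 (w i))).
      by rewrite /err addrAC !subrKA.
    rewrite (le_trans (ler_normD _ _))// lerD ?errl// distrC (le_trans (lbl _ _))//.
    rewrite -mulrA ler_wpM2l//.
    by rewrite (le_trans (ler_blop (V0 - R0) _))// ler_wpM2r.
  have V2n : `|V2| <= e / 3 + b * (e / 3 / C) * A.
    rewrite /V2 (le_trans (ler_norm_sum _ _ _))//.
    rewrite (@le_trans _ _ (\sum_(i <- s) (`|i.2| * (e / 3 / M) +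
       b * (e / 3 / C) * (`|i.2| * `|w i|))))//.
      rewrite big_seq [leRHS]big_seq; apply: ler_sum => i si.
      rewrite (le_trans (rank1_norm _ _))// (le_trans (ler_wpM2l _ (V2i i si)))//.
      by rewrite mulrDr lerD2l mulrCA.
    rewrite big_split/= -mulr_sumr -mulr_suml lerD//.
    rewrite mulrA ler_pdivrMr// mulrC ler_wpM2l ?(ltW e3)//.
    by rewrite lerDl.
  have dC : e / 3 / C * (b * (1 + A) + 1) = e / 3 by rewrite divfK// gt_eqF.
  have d0 : 0 < e / 3 / C by rewrite divr_gt0.
  have hR : b * `|R0| <= b * `|V0| + b * (e / 3 / C).
    by rewrite -mulrDr ler_wpM2l.
  rewrite (le_trans (ler_normD _ _))// (le_trans (lerD V1l V2n))//.
  have : b * (e / 3 / C) + b * (e / 3 / C) * A <= e / 3.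
    by move: dC d0; move: (e / 3 / C) => d; lra.
  lra.
- apply: blop_eqP => z.
  pose z' := \sum_(i <- s) (<[i.2, T (P z)]> : R) *: i.1.
  have Tz : T (P z) = T (P z').
    by rewrite [LHS](sP z) /z' !linear_sum; apply: eq_bigr => i _; rewrite !linearZ.
  have -> : ((V1 l + V2) \oL T \oL P) z = f (P z').
    transitivity (V1 l (T (P z)) + V2 (T (P z))); first by [].
    rewrite [V2 _]blop_sumE.
    have -> : f (P z') = \sum_(i <- s) (<[i.2, T (P z)]> : R) *: f (P i.1).
      by rewrite /z' !linear_sum; apply: eq_bigr => i _; rewrite !linearZ.
    have -> : V1 l (T (P z)) = \sum_(i <- s) (<[i.2, T (P z)]> : R) *: V1 l (w i).
      rewrite {1}Tz /z' !linear_sum; apply: eq_bigr => i _.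
      by rewrite !linearZ.
    rewrite -big_split; apply: eq_bigr => i _ /=.
    by rewrite -scalerDr addrC subrK.
  (* [P z'] and [P z] may differ, but [T] identifies them, and [|f x| <= b |V0 T x|] then makes
     their values under [f] equal. *)
  have W0 : (V0 \oL T) (P z' - P z) = 0 by rewrite linearB /= Tz subrr.
  have := lipschitz_approx_norm_le (P z' - P z) hP.
  by rewrite W0 normr0 mulr0 normr_le0 linearB subr_eq0 => /eqP.
Qed.
End FiniteRankFactorization.

(* With this norm, ['L(l1fin R, X)] is the l-infinity sum of countably many copies
   of the Banach space [X]. *)
Definition l1fin (R : realType) : Type := {poly R}.

(** * Polynomials as finitely supported sequences with the l1 norm *)

Section L1fin.
Context {R : realType}.

HB.instance Definition _ := GRing.Lmodule.on (l1fin R).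

Definition l1fin_norm (p : l1fin R) : R := \sum_(i < size (p : {poly R})) `|(p : {poly R})`_i|.

Lemma l1fin_normE (p : l1fin R) n : (size (p : {poly R}) <= n)%N ->
  l1fin_norm p = \sum_(i < n) `|(p : {poly R})`_i|.
Proof.
move=> pn; rewrite /l1fin_norm (big_ord_widen n (fun i => `|(p : {poly R})`_i|) pn).
rewrite [RHS](bigID (fun i : 'I_n => (i < size (p : {poly R}))%N))/= [X in _ = _ + X]big1 ?addr0//.
by move=> i; rewrite -leqNgt => pi; rewrite nth_default// normr0.
Qed.

Lemma l1fin_normD (p q : l1fin R) : l1fin_norm (p + q) <= l1fin_norm p + l1fin_norm q.
Proof.
pose n := maxn (size (p : {poly R})) (size (q : {poly R})).
rewrite (@l1fin_normE _ n) ?size_polyD// (@l1fin_normE p n) ?leq_maxl//.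
rewrite (@l1fin_normE q n) ?leq_maxr// -big_split/=.
by apply: ler_sum => i _; rewrite coefD ler_normD.
Qed.

Lemma l1fin_normZ (a : R) (p : l1fin R) : l1fin_norm (a *: p) = `|a| * l1fin_norm p.
Proof.
rewrite (@l1fin_normE _ (size (p : {poly R}))) ?size_scale_leq// /l1fin_norm mulr_sumr.
by apply: eq_bigr => i _; rewrite coefZ normrM.
Qed.

Lemma l1fin_norm0_eq0 (p : l1fin R) : l1fin_norm p = 0 -> p = 0.
Proof.
move=> /eqP; rewrite psumr_eq0// => /allP p0; apply/polyP => i; rewrite coef0.
have [ip|ip] := ltnP i (size (p : {poly R})); last by rewrite nth_default.
by have := p0 (Ordinal ip); rewrite mem_index_enum => /(_ isT)/implyP/(_ isT); rewrite normr_eq0 => /eqP.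
Qed.

HB.instance Definition _ :=
  Lmodule_isNormed.Build R (l1fin R) l1fin_normD l1fin_normZ l1fin_norm0_eq0.

Lemma l1fin_coef_bounded k : bounded_linear (fun p : l1fin R => (p : {poly R})`_k : R^o).
Proof.
apply: (@bounded_linear_of _ _ _ _ 1) => [p q|a p|p]; rewrite ?coefD ?coefZ// mul1r.
have [kp|kp] := ltnP k (size (p : {poly R})).
  rewrite [leRHS]/(l1fin_norm p) /l1fin_norm (bigD1 (Ordinal kp))//= lerDl.
  by apply: sumr_ge0.
by rewrite nth_default// normr0.
Qed.

Definition l1fin_coord k : dual (l1fin R) := mkblop (l1fin_coef_bounded k).

Definition l1fin_basis k : l1fin R := 'X^k.

Lemma l1fin_coord_norm k : `|l1fin_coord k| <= 1.
Proof.
apply: blop_norm_le => // p; rewrite mul1r.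
have [kp|kp] := ltnP k (size (p : {poly R})).
  rewrite [leRHS]/(l1fin_norm p) /l1fin_norm (bigD1 (Ordinal kp))//= lerDl.
  by apply: sumr_ge0.
by rewrite /= nth_default// normr0.
Qed.

Lemma l1fin_basis_norm k : `|l1fin_basis k| <= 1.
Proof.
rewrite [leLHS]/(l1fin_norm _) /l1fin_norm /l1fin_basis size_polyXn big_ord_recr/=.
rewrite big1 => [|i _]; first by rewrite coefXn eqxx normr1 add0r.
by rewrite coefXn ltn_eqF// normr0.
Qed.

Lemma l1fin_coord_basis j k : <[l1fin_coord j, l1fin_basis k]> = (j == k)%:R :> R.
Proof. by rewrite /= coefXn. Qed.

End L1fin.

(** * Countable l-infinity sums *)

Section CountableSum.
Context {R : realType}.

(** A bounded sequence in [X] is encoded by the operator taking these values on [l1fin_basis];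
    completeness is then that of an operator space. *)
Definition csum (X : completeNormedModType R) : completeNormedModType R :=
  'L(l1fin R, X).

Lemma csum_inj_bounded (X : completeNormedModType R) k :
  bounded_linear (fun x : X => rank1 (l1fin_coord k) x : csum X).
Proof.
apply: (@bounded_linear_of _ _ _ _ 1) => [x y|a x|x].
- by apply: blop_eqP => p; exact: scalerDr.
- by apply: blop_eqP => p; rewrite /= [RHS]scalerA mulrC -scalerA.
- by rewrite (le_trans (rank1_norm _ _))// ler_wpM2r// l1fin_coord_norm.
Qed.

Definition csum_inj (X : completeNormedModType R) k : 'L(X, csum X) :=
  mkblop (csum_inj_bounded X k).

Lemma csum_proj_bounded (X : completeNormedModType R) k :
  bounded_linear (fun z : csum X => (z : 'L(l1fin R, X)) (l1fin_basis k)).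
Proof.
apply: (@bounded_linear_of _ _ _ _ 1) => // z.
rewrite (le_trans (ler_blop (z : 'L(l1fin R, X)) _))// mul1r ler_piMr//.
exact: l1fin_basis_norm.
Qed.

Definition csum_proj (X : completeNormedModType R) k : 'L(csum X, X) :=
  mkblop (csum_proj_bounded X k).

Lemma csum_inj_norm (X : completeNormedModType R) k : `|csum_inj X k| <= 1.
Proof.
apply: blop_norm_le => // x; rewrite (le_trans (rank1_norm _ _))// ler_wpM2r//.
exact: l1fin_coord_norm.
Qed.

Lemma csum_proj_norm (X : completeNormedModType R) k : `|csum_proj X k| <= 1.
Proof.
apply: blop_norm_le => // z; rewrite (le_trans (ler_blop (z : 'L(l1fin R, X)) _))//.
by rewrite mulrC ler_wpM2r// l1fin_basis_norm.
Qed.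

Lemma csum_projK (X : completeNormedModType R) j k (x : X) :
  csum_proj X j (csum_inj X k x) = (k == j)%:R *: x.
Proof. by rewrite -(@l1fin_coord_basis R). Qed.

Lemma csum_proj_sum (X Y : completeNormedModType R) (T : nat -> 'L(Y, X)) n k y :
  csum_proj X k (\sum_(j < n) (csum_inj X j \oL T j) y) = if (k < n)%N then T k y else 0.
Proof.
rewrite linear_sum.
transitivity (\sum_(j < n) (j == k :> nat)%:R *: T j y).
  by apply: eq_bigr => j _; exact: csum_projK.
case: ifP => [kn|/negbT]; last first.
  rewrite -leqNgt => nk; rewrite big1// => j _.
  by rewrite ltn_eqF ?scale0r// (leq_trans (ltn_ord j)).
rewrite (bigD1 (Ordinal kn))//= eqxx scale1r big1 ?addr0// => j jk.
by rewrite -val_eqE/= in jk; rewrite (negbTE jk) scale0r.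
Qed.

End CountableSum.

(** * Geometrically convergent series *)

Section GeometricSeries.
Context {R : realType}.

Lemma geometric_tail (N : nat -> R) (C : R) : (forall k, N k.+1 <= C / 2 ^+ k.+1) ->
  forall n m, (n <= m)%N -> \sum_(n.+1 <= k < m.+1) N k <= C / 2 ^+ n - C / 2 ^+ m.
Proof.
move=> NC n m /subnKC <-; elim: (m - n)%N => [|d IH].
  by rewrite addn0 big_geq// subrr.
rewrite addnS big_nat_recr/=; last by rewrite ltnS leq_addr.
have := NC (n + d)%N; rewrite exprS.
have n0 : (2 : R) ^+ (n + d) != 0 by rewrite expf_neq0.
rewrite (_ : C / (2 * 2 ^+ (n + d)) = C / 2 ^+ (n + d) / 2); last by field.
by move: IH; lra.
Qed.

Lemma geometric_small (C e : R) : 0 < e -> exists n : nat, C / 2 ^+ n <= e.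
Proof.
move=> e0; pose n := Num.bound (`|C| / e); exists n.
rewrite ler_pdivrMr ?exprn_gt0// (le_trans (ler_norm _))// mulrC -ler_pdivrMr//.
rewrite (le_trans (ltW (archi_boundP _))) ?divr_ge0 ?(ltW e0)// -/n.
by rewrite -natrX ler_nat ltnW// ltn_expl.
Qed.

Lemma geometric_series (X : completeNormedModType R) (t : nat -> X) (C : R) :
  (forall k, `|t k.+1| <= C / 2 ^+ k.+1) ->
  exists l, forall n, `|l - \sum_(k < n.+1) t k| <= C / 2 ^+ n.
Proof.
move=> tC; pose u n := \sum_(k < n.+1) t k.
have C0 : 0 <= C.
  have := le_trans (normr_ge0 _) (tC 0%N).
  by rewrite pmulr_lge0// invr_gt0 exprn_gt0.
have udist n m : (n <= m)%N -> `|u m - u n| <= C / 2 ^+ n - C / 2 ^+ m.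
  move=> nm; rewrite /u -!(big_mkord xpredT t) (@big_cat_nat _ _ _ n.+1)//=.
  rewrite addrAC subrr add0r (le_trans (ler_norm_sum _ _ _))//.
  exact: (geometric_tail (N := fun k => `|t k|)).
have pos n : 0 <= C / 2 ^+ n by rewrite divr_ge0.
have udist' n m : `|u n - u m| <= C / 2 ^+ n + C / 2 ^+ m.
  have := pos n; have := pos m.
  have [nm|/ltnW nm] := leqP n m; have := udist _ _ nm; last lra.
  by rewrite distrC; lra.
have hN n : exists N : nat, C / 2 ^+ N <= n.+1%:R^-1.
  by apply: geometric_small; rewrite invr_gt0.
have [N NP] := choice hN.
have [n m|l lP] := @complete_seq R X (fun n => u (N n)).
  by rewrite (le_trans (udist' _ _))// lerD.
exists l => n; apply/ler_addgt0Pr => e e0.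
have e20 : 0 < e / 2 by rewrite divr_gt0.
have [M _ hM] := near_infty_natSinv_lt (PosNum e20).
have hM' : M.+1%:R^-1 < e / 2 := hM M (leqnn M).
rewrite distrC -(subrKA (u (N M))) (le_trans (ler_normD _ _))//.
have := le_trans (lP M) (ltW hM'); have := le_trans (NP M) (ltW hM').
by have := udist' n (N M); lra.
Qed.
End GeometricSeries.

(** * Series in the ideal and in its minimal kernel *)

Section IdealSeries.
Context {R : realType} (A : op_class R).
Hypothesis idA : banach_operator_ideal A.
Implicit Types E F G H X Y : completeNormedModType R.

(** Sandwiched between a vector and a functional, [T] becomes a multiple of the identity of the
    line, where the ideal norm is known. *)
Lemma blop_norm_le_ideal E F (T : 'L(E, F)) : A E F T -> `|T| <= op_norm A T.
Proof.
move=> AT; apply: blop_norm_le_dual => [|x phi phi1]; first exact: (ideal_norm_ge0 idA).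
pose ux : 'L(R^o, E) := rank1 (blop_id R^o : dual R^o) x.
have ux1 : `|ux| <= `|x|.
  rewrite (le_trans (rank1_norm _ _))// ler_piMl//.
  by apply: blop_norm_le => // t; rewrite mul1r.
have -> : <[phi, T x]> = <[phi, T x]> *: 1 :> R^o by rewrite [RHS]mulr1.
have E1 : (phi : 'L(F, R^o)) \oL T \oL ux = <[phi, T x]> *: blop_id R^o.
  apply: blop_eqP => t; rewrite /= linearZ/= pairingZ.
  by rewrite [RHS]mulrC.
have := ideal_norm_comp idA ux (phi : 'L(F, R^o)) AT.
rewrite E1 (ideal_normZ idA)//; last exact: (ideal_id idA).
rewrite (ideal_id_norm idA) mulr1 [_ *: 1]mulr1 => h.
rewrite (le_trans (ler_norm _))// (le_trans h)// ler_pM//.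
  by rewrite mulr_ge0// (ideal_norm_ge0 idA).
by rewrite ler_piMl// (ideal_norm_ge0 idA).
Qed.

Lemma ideal_sum E F (I : Type) (s : seq I) (t : I -> 'L(E, F)) :
  (forall i, A E F (t i)) ->
  A E F (\sum_(i <- s) t i) /\ op_norm A (\sum_(i <- s) t i) <= \sum_(i <- s) op_norm A (t i).
Proof.
move=> At; elim: s => [|i s [IH1 IH2]].
  rewrite !big_nil; split; first exact: (ideal0 idA).
  by rewrite -(scale0r (0 : 'L(E, F))) (ideal_normZ idA) ?normr0 ?mul0r//; exact: (ideal0 idA).
rewrite !big_cons; split; first exact: (idealD idA).
by rewrite (le_trans (ideal_normD idA (At i) IH1))// lerD2l.
Qed.

(** The series converges in the ideal norm, which dominates the operator norm, so both sums
    agree. *)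
Lemma ideal_series E F (t : nat -> 'L(E, F)) (C : R) :
  (forall k, A E F (t k)) -> (forall k, op_norm A (t k.+1) <= C / 2 ^+ k.+1) ->
  exists T, [/\ A E F T, op_norm A T <= op_norm A (t 0%N) + C &
    forall n, `|T - \sum_(k < n.+1) t k| <= C / 2 ^+ n].
Proof.
move=> At tC; pose u n := \sum_(k < n.+1) t k.
have C0 : 0 <= C.
  have := le_trans (ideal_norm_ge0 idA (At 1%N)) (tC 0%N).
  by rewrite pmulr_lge0// invr_gt0 exprn_gt0.
have Au n : A E F (u n) by have [] := ideal_sum (index_enum 'I_n.+1) (fun k : 'I_n.+1 => At k).
have AN S T : A E F S -> A E F T -> A E F (S - T).
  by move=> AS AT; rewrite -scaleN1r; apply: (idealD idA) => //; exact: (idealZ idA).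
have Nsym S T : A E F S -> A E F T -> op_norm A (S - T) = op_norm A (T - S).
  move=> AS AT; rewrite -(opprB T S) -scaleN1r (ideal_normZ idA); last exact: AN.
  by rewrite normrN normr1 mul1r.
have udist n m : (n <= m)%N -> op_norm A (u m - u n) <= C / 2 ^+ n.
  move=> nm; rewrite /u -!(big_mkord xpredT t) (@big_cat_nat _ _ _ n.+1)//=.
  rewrite addrAC subrr add0r.
  have [_ h] := ideal_sum (index_iota n.+1 m.+1) At.
  rewrite (le_trans h)// (le_trans (geometric_tail (N := fun k => op_norm A (t k)) tC nm))//.
  by rewrite gerBl divr_ge0.
have mono n m : (n <= m)%N -> C / 2 ^+ m <= C / 2 ^+ n.
  by move=> nm; rewrite ler_wpM2l// lef_pV2 ?posrE ?exprn_gt0// ler_weXn2l// ler1n.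
have [|T AT TP] := ideal_complete idA Au.
  move=> e e0; have [N hN] := geometric_small C (divr_gt0 e0 (ltr0Sn R 1)).
  exists N => m n Nm Nn.
  rewrite (@le_lt_trans _ _ (e / 2))//; last lra.
  have [nm|/ltnW mn] := leqP n m.
    by rewrite (le_trans (udist _ _ nm))// (le_trans (mono _ _ Nn)).
  by rewrite Nsym// (le_trans (udist _ _ mn))// (le_trans (mono _ _ Nm)).
exists T; split=> //.
  apply/ler_addgt0Pr => e /TP[N hN].
  have hT := hN N (leqnn N); rewrite Nsym// in hT.
  have -> : T = (T - u N) + (u N - u 0%N) + t 0%N.
    by rewrite subrKA /u big_ord1 subrK.
  have h1 := ideal_normD idA (AN _ _ AT (Au N)) (AN _ _ (Au N) (Au 0%N)).
  have h2 := ideal_normD idA (idealD idA (AN _ _ AT (Au N)) (AN _ _ (Au N) (Au 0%N))) (At 0%N).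
  have h3 := udist 0%N N (leq0n N); rewrite expr0 divr1 in h3.
  by move: hT h1 h2 h3; lra.
move=> n; apply/ler_addgt0Pr => e /TP[N hN].
have h1 := udist n (maxn n N) (leq_maxl _ _).
have h2 := hN (maxn n N) (leq_maxr _ _); rewrite Nsym// in h2.
have h3 := blop_norm_le_ideal (AN _ _ AT (Au (maxn n N))).
have h4 := blop_norm_le_ideal (AN _ _ (Au (maxn n N)) (Au n)).
rewrite -(subrKA (u (maxn n N))) (le_trans (ler_normD _ _))//.
by move: h1 h2 h3 h4; rewrite -/(u n); lra.
Qed.

Lemma geometric_eq0 X (x : X) (C : R) k : 
  (forall n, (k <= n)%N -> `|x| <= C / 2 ^+ n) -> x = 0.
Proof.
move=> h; apply/eqP; rewrite -normr_le0; apply/ler_addgt0Pr => e e0; rewrite add0r.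
have C0 : 0 <= C.
  have := le_trans (normr_ge0 _) (h k (leqnn k)).
  by rewrite pmulr_lge0// invr_gt0 exprn_gt0.
have [n hn] := geometric_small C e0.
rewrite (le_trans (h (k + n)%N (leq_addr _ _)))// (le_trans _ hn)// ler_wpM2l//.
by rewrite lef_pV2 ?posrE ?exprn_gt0// ler_weXn2l ?leq_addl// ler1n.
Qed.

Lemma minimal_kernel_le G H E F (u : 'L(E, G)) (S : 'L(G, H)) (v : 'L(H, F)) :
  approximable u -> A G H S -> approximable v ->
  op_norm (minimal_kernel A) (v \oL S \oL u) <= `|v| * op_norm A S * `|u|.
Proof.
move=> ua AS va; apply: ge_inf; last by exists G, H, u, S, v.
exists 0 => _ [G' [H' [u' [S' [v' [_ AS' _ _ ->]]]]]].
by rewrite !mulr_ge0// (ideal_norm_ge0 idA).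
Qed.

(* All the terms are factored simultaneously through l-infinity sums of copies of
   [G] and of [H]; the weights [g k] make the two outer factors approximable and
   the inner one a convergent series in [A]. *)
Lemma minimal_kernel_series E F G H (S : 'L(G, H)) (f : 'L(E, F))
    (D : nat -> 'L(E, G)) (V : nat -> 'L(H, F)) (B e : R) (g : nat -> R) :
  A G H S -> 0 < e -> g 0%N = 1 -> (forall k, 0 < g k) ->
  (forall k, approximable (D k)) -> (forall k, approximable (V k)) ->
  (forall k, g k.+1 * (B + op_norm A S) <= e / 2 ^+ k.+1) ->
  (forall k, `|V k.+1| <= B) ->
  (forall k, `|D k.+1| <= g k.+1 ^+ 2 * (e / 2 ^+ k.+1)) ->
  (forall x (d : R), 0 < d -> exists N : nat, forall n, (N <= n)%N ->
    `|\sum_(k < n.+1) V k (S (D k x)) - f x| <= d) ->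
  minimal_kernel A E F f /\
  op_norm (minimal_kernel A) f <= (`|V 0%N| + e) * (op_norm A S + e) * (`|D 0%N| + e).
Proof.
move=> AS e0 g0 gpos Da Va gB VB Dg Df.
have gge k : 0 <= g k := ltW (gpos k).
have B0 : 0 <= B := le_trans (normr_ge0 _) (VB 0%N).
have NS0 := ideal_norm_ge0 idA AS.
(* The weights [g^-2], [g] and [g] cancel in the composition. The decay of [D k] pays for the first;
   the other two make the merely bounded [V k] and the repeated [S] summable. *)
pose tu k := csum_inj G k \oL ((g k ^- 2) *: D k).
pose tv k := ((g k) *: V k) \oL csum_proj H k.
pose tS k := csum_inj H k \oL ((g k) *: S) \oL csum_proj G k.
have AtS k : A _ _ (tS k) by apply: (ideal_comp idA); exact: (idealZ idA).
have NtS k : op_norm A (tS k) <= g k * op_norm A S.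
  have h := ideal_norm_comp idA (csum_proj G k) (csum_inj H k) (idealZ idA (g k) AS).
  rewrite (le_trans h)// (ideal_normZ idA)// ger0_norm//.
  rewrite -[leRHS]mulr1 ler_pM ?mulr_ge0 ?csum_proj_norm//.
  by rewrite ler_piMl ?mulr_ge0 ?csum_inj_norm.
have [u uP] : exists u, forall n, `|u - \sum_(k < n.+1) tu k| <= e / 2 ^+ n.
  apply: geometric_series => k.
  rewrite (le_trans (blop_comp_norm _ _))// (@le_trans _ _ `|(g k.+1 ^- 2) *: D k.+1|)//.
    by rewrite ler_piMl// csum_inj_norm.
  rewrite normrZ ger0_norm ?invr_ge0 ?exprn_ge0// mulrC ler_pdivrMr ?exprn_gt0//.
  by rewrite mulrC.
have [v vP] : exists v, forall n, `|v - \sum_(k < n.+1) tv k| <= e / 2 ^+ n.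
  apply: geometric_series => k.
  rewrite (le_trans (blop_comp_norm _ _))// (@le_trans _ _ `|(g k.+1) *: V k.+1|)//.
    by rewrite ler_piMr// csum_proj_norm.
  rewrite normrZ ger0_norm// (le_trans _ (gB k))// ler_wpM2l//.
  by rewrite (le_trans (VB k))// lerDl.
have [k|S' [AS' NS' S'P]] := ideal_series AtS (C := e).
  rewrite (le_trans (NtS _))// (le_trans _ (gB k))// ler_wpM2l//.
  by rewrite lerDr.
have ua : approximable u.
  apply: approximable_limit => d d0; have [n hn] := geometric_small e d0.
  exists (\sum_(k < n.+1) tu k); last exact: le_trans (uP n) hn.
  apply: approximable_bigsum => k; apply: approximable_compr; exact: approximableZ.
have va : approximable v.
  apply: approximable_limit => d d0; have [n hn] := geometric_small e d0.
  exists (\sum_(k < n.+1) tv k); last exact: le_trans (vP n) hn.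
  apply: approximable_bigsum => k; apply: approximable_compl; exact: approximableZ.
have un : `|u| <= `|D 0%N| + e.
  have := uP 0%N; rewrite expr0 divr1 big_ord1 => h.
  rewrite -(subrK (tu 0%N) u) (le_trans (ler_normD _ _))// addrC lerD//.
  rewrite (le_trans (blop_comp_norm _ _))// g0 expr1n invr1 scale1r ler_piMl//.
  exact: csum_inj_norm.
have vn : `|v| <= `|V 0%N| + e.
  have := vP 0%N; rewrite expr0 divr1 big_ord1 => h.
  rewrite -(subrK (tv 0%N) v) (le_trans (ler_normD _ _))// addrC lerD//.
  rewrite (le_trans (blop_comp_norm _ _))// g0 scale1r ler_piMr//.
  exact: csum_proj_norm.
have S'n : op_norm A S' <= op_norm A S + e.
  by rewrite (le_trans NS')// lerD2r (le_trans (NtS _))// g0 mul1r.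
have bound (X Y : completeNormedModType R) (T T' : 'L(X, Y)) n x :
    `|T - T'| <= e / 2 ^+ n -> `|T x - T' x| <= e * `|x| / 2 ^+ n.
  move=> h; rewrite (le_trans (ler_blop (T - T') x))// mulrAC.
  by rewrite ler_wpM2r.
(* Coordinate [k] is the same in all partial sums from index [k] on, hence also in the limit. *)
have Qu k x : csum_proj G k (u x) = (g k ^- 2) *: D k x.
  apply/eqP; rewrite -subr_eq0; apply/eqP.
  apply: (@geometric_eq0 _ _ (e * `|x|) k) => n kn.
  have -> : (g k ^- 2) *: D k x = csum_proj G k ((\sum_(j < n.+1) tu j) x).
    rewrite blop_sumE (csum_proj_sum (fun j => (g j ^- 2) *: D j)) ltnS kn.
    by [].
  rewrite -linearB (le_trans (ler_blop (csum_proj G k) _))//.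
  by rewrite (le_trans (ler_wpM2r _ (csum_proj_norm _ _)))// mul1r bound.
have QS k z : csum_proj H k (S' z) = g k *: S (csum_proj G k z).
  apply/eqP; rewrite -subr_eq0; apply/eqP.
  apply: (@geometric_eq0 _ _ (e * `|z|) k) => n kn.
  have -> : g k *: S (csum_proj G k z) = csum_proj H k ((\sum_(j < n.+1) tS j) z).
    have h := csum_proj_sum (fun j => (g j *: S) \oL csum_proj G j) n.+1 k z.
    rewrite ltnS kn in h; rewrite blop_sumE.
    by transitivity (((g k *: S) \oL csum_proj G k) z) => //; rewrite -h.
  rewrite -linearB (le_trans (ler_blop (csum_proj H k) _))//.
  by rewrite (le_trans (ler_wpM2r _ (csum_proj_norm _ _)))// mul1r bound.
have fE : f = v \oL S' \oL u.
  apply: blop_eqP => x; apply/eqP; rewrite -subr_eq0 -normr_le0.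
  apply/ler_addgt0Pr => d d0; rewrite add0r.
  have d20 : 0 < d / 2 by rewrite divr_gt0.
  have [N hN] := Df x _ d20.
  pose z := S' (u x).
  have [n hn] := geometric_small (e * `|z|) d20.
  pose m := maxn N n.
  have h1 := hN m (leq_maxl _ _).
  have h2 := bound _ _ _ _ _ z (vP m).
  have h3 : e * `|z| / 2 ^+ m <= d / 2.
    rewrite (le_trans _ hn)// ler_wpM2l ?mulr_ge0 ?(ltW e0)//.
    by rewrite lef_pV2 ?posrE ?exprn_gt0// ler_weXn2l ?leq_maxr// ler1n.
  have vz : (\sum_(k < m.+1) tv k) z = \sum_(k < m.+1) V k (S (D k x)).
    rewrite blop_sumE; apply: eq_bigr => k _.
    transitivity (g k *: V k (csum_proj H k z)); first by [].
    rewrite QS Qu !linearZ/= !scalerA (_ : _ * _ = 1) ?scale1r//.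
    by field; rewrite gt_eqF.
  rewrite vz in h2.
  rewrite distrC -(subrKA (\sum_(k < m.+1) V k (S (D k x)))) (le_trans (ler_normD _ _))//.
  by rewrite -/z (splitr d) lerD// (le_trans h2).
split; first by exists (csum G), (csum H), u, S', v.
rewrite fE (le_trans (minimal_kernel_le ua AS' va))//.
have NS'0 := ideal_norm_ge0 idA AS'.
by rewrite ler_pM ?mulr_ge0// ler_pM.
Qed.

End IdealSeries.

(** * Membership in the minimal kernel with norm bounds *)

Section LipschitzFactorization.
Context {R : realType} (A : op_class R).
Hypothesis idA : banach_operator_ideal A.
Implicit Types E F G H : completeNormedModType R.

Lemma le_product_limit (r x y z : R) : 0 <= x -> 0 <= y -> 0 <= z ->
  (forall e : R, 0 < e -> e <= 1 -> r <= (x + 2 * e) * (y + e) * (z + 2 * e)) ->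
  r <= x * y * z.
Proof.
move=> x0 y0 z0 h; apply/ler_addgt0Pr => d d0.
(* [K] collects the coefficients of all positive powers of [e] in the expanded product; [e <= 1]
   bounds these powers by [e]. *)
pose K := 2 * x * y + x * z + 2 * y * z + 2 * x + 4 * y + 2 * z + 4.
have xy := mulr_ge0 x0 y0; have xz := mulr_ge0 x0 z0; have yz := mulr_ge0 y0 z0.
have K0 : 0 < K by rewrite /K; lra.
pose e := Num.min 1 (d / K).
have e0 : 0 < e by rewrite lt_min ltr01 divr_gt0.
have e1 : e <= 1 by rewrite ge_min lexx.
have eK : e * K <= d by rewrite -ler_pdivlMr// ge_min lexx orbT.
rewrite (le_trans (h e e0 e1))//.
have e2 : 0 <= e - e * e by rewrite -{1}(mulr1 e) -mulrBr mulr_ge0 ?subr_ge0// ltW.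
have e3 : 0 <= e * (e - e * e) by rewrite mulr_ge0// ltW.
have h1 := mulr_ge0 x0 e2; have h2 := mulr_ge0 y0 e2; have h3 := mulr_ge0 z0 e2.
by move: eK; rewrite /K; lra.
Qed.

Lemma minimal_kernel_of_approximation_property E G H (G2 F : completeNormedModType R)
    (D : 'L(E, G)) (S : 'L(G, H)) (V0 : 'L(H, G2)) (f : 'L(E, F)) (b : R) :
  approximation_property (dual E) -> 0 <= b ->
  approximable D -> A G H S -> approximable V0 ->
  lipschitz_approx b (V0 \oL S \oL D) f ->
  minimal_kernel A E F f /\
  op_norm (minimal_kernel A) f <= b * `|V0| * op_norm A S * `|D|.
Proof.
move=> AP b0 Da AS V0a hP.
have NS0 := ideal_norm_ge0 idA AS.
pose B := b * `|V0| + 1.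
have B1 : 1 <= B by rewrite lerDr mulr_ge0.
have BN0 : 0 < B + op_norm A S by rewrite ltr_wpDr// (lt_le_trans ltr01).
suff key (e : R) : 0 < e -> e <= 1 -> minimal_kernel A E F f /\
    op_norm (minimal_kernel A) f <=
      (b * `|V0| + 2 * e) * (op_norm A S + e) * (`|D| + 2 * e).
  have [? _] := key 1 ltr01 (lexx _); split=> //.
  apply: le_product_limit => //; first exact: mulr_ge0.
  by move=> e e0 e1; have [] := key e e0 e1.
move=> e0 e1.
(* Positive indices get the weight with [g k * (B + op_norm A S) = e / 2 ^+ k]; weight 1 at index 0
   lets the leading term determine the norms up to [e]. *)
pose g k := if k is 0 then 1 else e / 2 ^+ k / (B + op_norm A S).
have ek k : 0 < e / 2 ^+ k by rewrite divr_gt0// exprn_gt0.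
have g0 k : 0 < g k by case: k => [|k] //=; rewrite divr_gt0.
pose w k := g k ^+ 2 * (e / 2 ^+ k).
have w0 k : 0 < w k by rewrite mulr_gt0// exprn_gt0.
(* [D] composed with [P' k.+1] is a difference of the errors at [k] and [k.+1], each allowed half of
   [w k.+1]; the third bound gives convergence and controls the leading term. *)
pose d k := Num.min (w k / 2) (Num.min (w k.+1 / 2) (e / 2 ^+ k)).
have d0 k : 0 < d k by rewrite !lt_min ek !divr_gt0.
have dw k : d k <= w k / 2 by rewrite ge_min lexx.
have dwS k : d k <= w k.+1 / 2 by rewrite !ge_min lexx orbT.
have de k : d k <= e / 2 ^+ k by rewrite !ge_min lexx !orbT.
have hPk k : exists P : 'L(E, E), finite_rank P /\ `|D - (D \oL P)| <= d k.
  by have [P] := approximation_property_dual AP Da (d0 k); exists P.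
have [P PP] := choice hPk.
pose P' k : 'L(E, E) := if k is k'.+1 then P k - P k' else P 0%N.
have P'f k : finite_rank (P' k).
  case: k => [|k]; first by have [] := PP 0%N.
  rewrite /P' -scaleN1r; apply: finite_rankD; first by have [] := PP k.+1.
  by apply: finite_rankZ; have [] := PP k.
have hVk k : exists V : 'L(H, F), [/\ finite_rank V, `|V| <= b * `|V0| + e &
    (V \oL (S \oL D)) \oL P' k = f \oL P' k].
  by apply: (finite_rank_factorization b0 _ V0a (P'f k) e0); rewrite blop_compA.
have [V VP] := choice hVk.
have DS k : `|D \oL P' k.+1| <= w k.+1.
  have -> : D \oL P' k.+1 = (D - (D \oL P k)) - (D - (D \oL P k.+1)).
    by rewrite opprB addrC subrKA blop_compBr.
  have [_ h1] := PP k; have [_ h2] := PP k.+1.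
  rewrite (le_trans (ler_normB _ _))// (splitr (w k.+1)) lerD//.
    exact: le_trans h1 (dwS k).
  exact: le_trans h2 (dw k.+1).
have D0 : `|D \oL P' 0%N| <= `|D| + e.
  have [_ h] := PP 0%N; rewrite distrC in h.
  rewrite -(subrK D (D \oL _)) addrC (le_trans (ler_normD _ _))// lerD2l (le_trans h)//.
  by have := de 0%N; rewrite expr0 divr1.
have [||||||m1 m2] := @minimal_kernel_series R A idA E F G H S f
    (fun k => D \oL P' k) V B e g AS e0 erefl g0.
- by move=> k; exact: approximable_compl.
- by move=> k; apply: approximable_finite_rank; have [] := VP k.
- by move=> k; rewrite /g divfK// gt_eqF.
- by move=> k; have [_ h _] := VP k.+1; rewrite (le_trans h)// lerD2l.
- exact: DS.
- move=> x c c0.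
  pose C := b * `|V0 \oL S| * `|x| * e.
  have [N hN] := geometric_small C c0.
  exists N => n Nn.
  (* The sum telescopes to [f (P n x)]. Here [P n x] need not tend to [x]; convergence of
     [D (P n x)] suffices because [f] is dominated by [V0 o S o D]. *)
  have -> : \sum_(k < n.+1) V k (S ((D \oL P' k) x)) = f (P n x).
    transitivity (\sum_(k < n.+1) f (P' k x)).
      apply: eq_bigr => k _; have [_ _ h] := VP k.
      by have := congr1 (fun T : 'L(E, F) => T x) h.
    elim: n {Nn} => [|n IH]; first by rewrite big_ord1.
    rewrite big_ord_recr/= IH.
    transitivity (f (P n x + (P n.+1 x - P n x))); first by rewrite [RHS]linearD.
    by rewrite addrC subrK.
  rewrite distrC -linearB (le_trans (lipschitz_approx_norm_le _ hP))//.
  rewrite (le_trans _ hN)// /C.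
  have h1 : `|D (x - P n x)| <= e / 2 ^+ n * `|x|.
    have -> : D (x - P n x) = (D - (D \oL P n)) x by rewrite linearB.
    rewrite (le_trans (ler_blop _ _))// ler_wpM2r//.
    by have [_ h] := PP n; exact: le_trans h (de n).
  have h2 : e / 2 ^+ n <= e / 2 ^+ N.
    rewrite ler_wpM2l ?(ltW e0)// lef_pV2 ?posrE ?exprn_gt0//.
    by rewrite ler_weXn2l// ler1n.
  rewrite -[in leRHS]mulrA [leRHS](_ : _ = b * (`|V0 \oL S| * (e / 2 ^+ N * `|x|))); last by ring.
  rewrite ler_wpM2l// (le_trans (ler_blop (V0 \oL S) _))// ler_wpM2l//.
  by rewrite (le_trans h1)// ler_wpM2r.
split=> //; rewrite (le_trans m2)//.
have [_ V0n _] := VP 0%N.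
rewrite ler_pM ?mulr_ge0 ?addr_ge0 ?(ltW e0)//; last lra.
by rewrite ler_pM ?addr_ge0 ?(ltW e0)//; lra.
Qed.

Lemma minimal_kernel_of_lipschitz_factorization E F (f : 'L(E, F))
    (G1 G H G2 : completeNormedModType R) (g1 : E -> G1) (T : 'L(G1, G)) (S : 'L(G, H))
    (V0 : 'L(H, G2)) (g2 : G2 -> F) (a b : R) :
  is_dual_space F \/ approximation_property (dual E) \/
    regular_ideal (minimal_kernel A) ->
  0 <= a -> (forall x y, `|g1 x - g1 y| <= a * `|x - y|) ->
  0 <= b -> (forall x y, `|g2 x - g2 y| <= b * `|x - y|) ->
  approximable T -> A G H S -> approximable V0 ->
  (forall x, f x = g2 (V0 (S (T (g1 x))))) ->
  minimal_kernel A E F f /\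
  op_norm (minimal_kernel A) f <= a * b * (`|V0| * op_norm A S * `|T|).
Proof.
move=> cases a0 g1a b0 g2b Ta AS V0a fE.
have NS0 := ideal_norm_ge0 idA AS.
have [D [Da DT hP]] := linearized_factorization (S := V0 \oL S) a0 g1a b0 g2b Ta fE.
have final (c : R) : c <= b * `|V0| * op_norm A S * `|D| ->
    c <= a * b * (`|V0| * op_norm A S * `|T|).
  move=> /le_trans; apply; rewrite (_ : a * b * _ = b * `|V0| * op_norm A S * (`|T| * a)); last by ring.
  by rewrite ler_wpM2l// !mulr_ge0.
have dual_case (K : normedModType R) (iota : 'L(F, dual K)) : `|iota| <= 1 ->
    exists L : 'L(G2, dual K), `|L| <= b /\ iota \oL f = L \oL V0 \oL S \oL D.
  move=> iota1; have [L Lb LE] := dual_valued_extension iota b0 hP.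
  exists L; split; first by rewrite (le_trans Lb)// ler_piMr.
  by rewrite -LE !blop_compA.
have LV0 (X Y : completeNormedModType R) (L : 'L(G2, X)) (Q : 'L(X, Y)) : `|L| <= b -> `|Q| <= 1 ->
    `|Q \oL (L \oL V0)| <= b * `|V0|.
  move=> Lb Q1; rewrite (le_trans (blop_comp_norm _ _))// -[leRHS]mul1r ler_pM//.
  by rewrite (le_trans (blop_comp_norm _ _))// ler_wpM2r.
case: cases => [[K [J [Jbij Jn]]]|[AP|[regm regn]]].
- have J1 : `|J| <= 1 by apply: blop_norm_le => // x; rewrite mul1r Jn.
  have [L [Lb LE]] := dual_case _ _ J1.
  have [Ji JK JiK] := Jbij.
  have Jib : bounded_linear Ji.
    apply: (@bounded_linear_of _ _ _ _ 1) => [x y|c x|x].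
    + by apply: (can_inj JK); rewrite JiK linearD/= !JiK.
    + by apply: (can_inj JK); rewrite JiK linearZ/= JiK.
    + by rewrite mul1r -{2}(JiK x) Jn.
  pose Q : 'L(dual K, F) := mkblop Jib.
  have Q1 : `|Q| <= 1.
    by apply: blop_norm_le => // x; rewrite mul1r -{2}(JiK x) Jn.
  have fQ : f = (Q \oL (L \oL V0)) \oL S \oL D.
    apply: blop_eqP => x; have := congr1 (fun T : 'L(E, dual K) => T x) LE.
    by move=> /= <-; rewrite JK.
  have QLa : approximable (Q \oL (L \oL V0)).
    by apply: approximable_compr; exact: approximable_compr.
  split; first by exists G, H, D, S, (Q \oL (L \oL V0)).
  apply: final; rewrite {1}fQ (le_trans (minimal_kernel_le idA Da AS QLa))//.
  by rewrite ler_wpM2r// ler_wpM2r// LV0.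
- have [m1 m2] := minimal_kernel_of_approximation_property AP b0 Da AS V0a hP.
  by split=> //; exact: final.
- have [L [Lb LE]] := dual_case _ _ (bidual_inclusion_norm_le1 F).
  have LVa : approximable (L \oL V0) by exact: approximable_compr.
  have mf : minimal_kernel A E F f.
    by rewrite regm /=; exists G, H, D, S, (L \oL V0).
  split=> //; apply: final; rewrite regn// [op_norm _ f]/(op_norm (minimal_kernel A) (bidual_inclusion F \oL f)).
  rewrite LE (le_trans (minimal_kernel_le idA Da AS LVa))//.
  rewrite ler_wpM2r// ler_wpM2r// (le_trans (blop_comp_norm _ _))//.
  by rewrite ler_wpM2r.
Qed.

End LipschitzFactorization.

(** * The linear part of the Lipschitz class and its norm *)

Theorem corollary2p5 (R : realType) (A : op_class R)
    (E F : completeNormedModType R) :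
  banach_operator_ideal A ->
  separable E ->
  is_dual_space F \/ approximation_property (dual E) \/
    regular_ideal (minimal_kernel A) ->
  lip_comp (minimal_kernel A) E F `&` [set f : E -> F | bounded_linear f] =
    [set f : E -> F | exists2 T : 'L(E, F), minimal_kernel A E F T & f = T] /\
  (forall T : 'L(E, F), minimal_kernel A E F T ->
    lip_comp_norm (minimal_kernel A) T = op_norm (minimal_kernel A) T).
Proof.
move=> idA _ cases.
have idlip (X : completeNormedModType R) (x y : X) : `|idfun x - idfun y| <= 1 * `|x - y|.
  by rewrite mul1r.
have idLip0 (X : completeNormedModType R) : Lip0 (@idfun X).
  split=> //; exists 1; split; first exact: num_real.
  move=> M M1 [x y] _ /=; rewrite -[leLHS]mul1r ler_wpM2r//; exact: ltW.
have key (f : 'L(E, F)) (G1 G2 : completeNormedModType R) (g1 : E -> G1)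
    (T : 'L(G1, G2)) (g2 : G2 -> F) : Lip0 g1 -> minimal_kernel A G1 G2 T -> Lip0 g2 ->
    f = g2 \o T \o g1 :> (E -> F) -> minimal_kernel A E F f /\
    op_norm (minimal_kernel A) f <= Lip g1 * op_norm (minimal_kernel A) T * Lip g2.
  move=> [lg1 _] mT [lg2 _] fE.
  have main (G H : completeNormedModType R) (U : 'L(G1, G)) (S : 'L(G, H)) (V : 'L(H, G2)) : approximable U ->
      A G H S -> approximable V -> T = V \oL S \oL U -> minimal_kernel A E F f /\
      op_norm (minimal_kernel A) f <= Lip g1 * Lip g2 * (`|V| * op_norm A S * `|U|).
    move=> Ua AS Va TE.
    apply: (minimal_kernel_of_lipschitz_factorization idA cases (Lip_ge0 g1) (LipP lg1)
      (Lip_ge0 g2) (LipP lg2) Ua AS Va).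
    by move=> x; rewrite fE /= TE.
  have [G [H [U [S [V [Ua AS Va TE]]]]]] := mT.
  have [mf _] := main G H U S V Ua AS Va TE.
  split=> //; rewrite mulrAC.
  have L0 : 0 <= Lip g1 * Lip g2 by rewrite mulr_ge0 ?Lip_ge0.
  (* To pass to the infimum over factorizations of [T], the product of Lipschitz constants is
     divided out; if it is 0, a single factorization already gives the bound. *)
  have [L00|Lpos] := eqVneq (Lip g1 * Lip g2) 0.
    by have [_] := main G H U S V Ua AS Va TE; rewrite L00 !mul0r.
  have {}Lpos : 0 < Lip g1 * Lip g2 by rewrite lt_neqAle eq_sym Lpos.
  rewrite mulrC -ler_pdivrMr//; apply: lb_le_inf.
    by exists (`|V| * op_norm A S * `|U|), G, H, U, S, V.
  move=> _ [G' [H' [U' [S' [V' [Ua' AS' Va' TE' ->]]]]]].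
  by rewrite ler_pdivrMr// mulrC; have [] := main G' H' U' S' V' Ua' AS' Va' TE'.
split.
  apply/seteqP; split=> f.
    move=> [[G1 [G2 [g1 [T [g2 [l1 mT l2 fE]]]]]] fb].
    exists (mkblop fb) => //.
    by have [] := key (mkblop fb) G1 G2 g1 T g2 l1 mT l2 fE.
  move=> [T mT ->]; split; last exact: blopP.
  by exists E, F, idfun, T, idfun; split.
move=> T mT; apply/eqP; rewrite eq_le; apply/andP; split.
  have op0 : 0 <= op_norm (minimal_kernel A) T.
    apply: inf_nonneg => _ [G [H [U [S [V [_ AS _ _ ->]]]]]].
    by rewrite !mulr_ge0// (ideal_norm_ge0 idA).
  apply: (@le_trans _ _ (Lip (@idfun E) * op_norm (minimal_kernel A) T * Lip (@idfun F))).
    apply: ge_inf.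
      exists 0 => _ [G1 [G2 [g1 [T' [g2 [_ [G [H [U [S [V [_ AS _ _]]]]]] _ _ ->]]]]]].
      rewrite !mulr_ge0 ?Lip_ge0//.
      apply: inf_nonneg => _ [G' [H' [U' [S' [V' [_ AS' _ _ ->]]]]]].
      by rewrite !mulr_ge0// (ideal_norm_ge0 idA).
    by exists E, F, idfun, T, idfun; split.
  rewrite -[leRHS]mul1r -[leRHS]mulr1 ler_pM ?mulr_ge0 ?Lip_ge0//; last exact: Lip_le.
  by rewrite ler_wpM2r//; exact: Lip_le.
apply: lb_le_inf.
  by exists (Lip (@idfun E) * op_norm (minimal_kernel A) T * Lip (@idfun F)), E, F, idfun, T, idfun; split.
by move=> _ [G1 [G2 [g1 [T' [g2 [l1 mT' l2 TE ->]]]]]]; have [] := key T G1 G2 g1 T' g2 l1 mT' l2 TE.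
Qed.
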